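(* Let $\alpha>1$ and $\kappa>0$ be fixed. For each $n$ let $p=n$, let $X\in\mathbb R^{n\times n}$ be an invertible design matrix, let $g=p^{2\alpha}$, and let $Y=w\sim\mathcal N(0,I_n)$ (so the true regression vector is zero). Use the untruncated prior $\pi(\gamma)=C\,p^{-\kappa|\gamma|}$ on the whole of $\{0,1\}^p$, so that the posterior is $$\pi_n(\gamma\mid Y)\ \propto\ p^{-\kappa|\gamma|}\,\frac{(1+g)^{-|\gamma|/2}}{(1+g(1-R_\gamma^2))^{n/2}},\qquad \gamma\in\{0,1\}^p .$$ Then the mixing time of the Metropolis–Hastings chain on $\{0,1\}^p$ described in the context grows exponentially in $n$ with probability at least $1/2$ with respect to the randomness of $w$; that is, for every fixed $\epsilon\in(0,1/2)$ there is a constant $c>0$ such that for all sufficiently large $n$, $\mathbb P(\tau_\epsilon\ge e^{cn})\ge\tfrac12$.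
   Context: A vector $\gamma\in\{0,1\}^p$ is identified with the subset $\{j:\gamma_j=1\}$ of $[p]=\{1,\dots,p\}$; $|\gamma|=\sum_j\gamma_j$. $X_j$ is the $j$-th column of $X$, $\Phi_\gamma$ is the orthogonal projection onto the span of $\{X_j:j\in\gamma\}$, and $R_\gamma^2=Y^T\Phi_\gamma Y/\|Y\|_2^2$. The posterior displayed in the claim arises from the hierarchical model $Y=X_\gamma\beta_\gamma+w$, $w\sim\mathcal N(0,\phi^{-1}I_n)$, $\pi(\phi)\propto1/\phi$, $\beta_\gamma\mid\gamma\sim\mathcal N(0,g\phi^{-1}(X_\gamma^TX_\gamma)^{-1})$, $\pi(\gamma)\propto p^{-\kappa|\gamma|}$, after integrating out $\beta_\gamma$ and $\phi$. Metropolis–Hastings chain. Let $d_H$ be Hamming distance, $S(\gamma)=\{j:\gamma_j=1\}$, $S^c(\gamma)=\{j:\gamma_j=0\}$, $\mathcal N_1(\gamma)=\{\gamma':d_H(\gamma',\gamma)=1\}$, and $\mathcal N_2(\gamma)$ the set of $\gamma'$ obtained from $\gamma$ by flipping one index $k\in S(\gamma)$ from 1 to 0 and one index $\ell\in S^c(\gamma)$ from 0 to 1. The transition matrix is $$\mathbf P_{MH}(\gamma,\gamma')=\begin{cases}\frac{1}{2p}\min\{1,\frac{\pi_n(\gamma'\mid Y)}{\pi_n(\gamma\mid Y)}\},&\gamma'\in\mathcal N_1(\gamma),\\[2pt] \frac{1}{2|S(\gamma)||S^c(\gamma)|}\min\{1,\frac{\pi_n(\gamma'\mid Y)}{\pi_n(\gamma\mid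 Y)}\},&\gamma'\in\mathcal N_2(\gamma),\\[2pt] 0,&\text{other }\gamma'\neq\gamma,\\ 1-\sum_{\gamma''\ne\gamma}\mathbf P_{MH}(\gamma,\gamma''),&\gamma'=\gamma.\end{cases}$$ Mixing time: with $\mathscr M=\{0,1\}^p$ and $\pi=\pi_n(\cdot\mid Y)$, let $\Delta_\gamma(t)=\max_{A\subset\mathscr M}|\mathbf P_{MH}^t(\gamma,A)-\pi(A)|$ and $\tau_\epsilon=\max_{\gamma\in\mathscr M}\min\{t\in\mathbb N:\Delta_\gamma(t')\le\epsilon\text{ for all }t'\ge t\}$. *)

(* Defs.v *)
From HB Require Import structures.
From mathcomp Require Import all_boot all_order all_algebra.
From mathcomp Require Import all_classical all_reals all_analysis.

Set Implicit Arguments.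
Unset Strict Implicit.
Unset Printing Implicit Defensive.

Import Order.TTheory GRing.Theory Num.Theory.
Import numFieldNormedType.Exports.

Local Open Scope classical_set_scope.
Local Open Scope ring_scope.

(* A vector gamma in {0,1}^p is represented by its support, a {set 'I_p}. *)

Section Posterior.
Context {R : realType} {n p : nat}.
Implicit Types (X : 'M[R]_(n, p)) (Y : 'cV[R]_n) (gamma : {set 'I_p}).

(* MathComp subspaces are row spaces, so the columns are transposed here and
   projections act on row vectors. *)
Definition col_span X gamma : 'M[R]_n :=
  (\sum_(j in gamma) <<(col j X)^T>>)%MS.

(* kermx U^T is the space of row vectors orthogonal to the row space of U. *)
Definition Phi X gamma : 'M[R]_n :=
  (proj_mx (col_span X gamma) (kermx (col_span X gamma)^T))^T.

Definition Rsq X Y gamma : R :=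
  (Y^T *m Phi X gamma *m Y) 0 0 / \sum_(i < n) Y i 0 ^+ 2.

Definition posterior_weight (kappa g : R) X Y gamma : R :=
  p%:R `^ (- (kappa * #|gamma|%:R)) *
  ((1 + g) `^ (- (#|gamma|%:R / 2)) /
   (1 + g * (1 - Rsq X Y gamma)) `^ (n%:R / 2)).

Definition posterior (kappa g : R) X Y gamma : R :=
  posterior_weight kappa g X Y gamma /
  \sum_(gamma' : {set 'I_p}) posterior_weight kappa g X Y gamma'.

End Posterior.

Section Chain.
Context {R : realType} {p : nat}.
Implicit Types (gamma : {set 'I_p}) (pi : {set 'I_p} -> R).

Definition hamming gamma gamma' : nat :=
  #|[pred j | (j \in gamma) != (j \in gamma')]|.

Definition N1 gamma gamma' : bool := hamming gamma' gamma == 1%N.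

Definition N2 gamma gamma' : bool :=
  [exists k in gamma, exists l in ~: gamma, gamma' == l |: (gamma :\ k)].

Definition MH_move pi gamma gamma' : R :=
  if N1 gamma gamma' then
    (2 * p%:R)^-1 * Num.min 1 (pi gamma' / pi gamma)
  else if N2 gamma gamma' then
    (2 * #|gamma|%:R * #|~: gamma|%:R)^-1 * Num.min 1 (pi gamma' / pi gamma)
  else 0.

Definition P_MH pi gamma gamma' : R :=
  if gamma' == gamma then
    1 - \sum_(gamma'' | gamma'' != gamma) MH_move pi gamma gamma''
  else MH_move pi gamma gamma'.

End Chain.

Section MixingTime.
Context {R : realType} {S : finType}.
Implicit Types (P : S -> S -> R) (pi : S -> R).

Fixpoint kernel_pow P (t : nat) (x y : S) : R :=
  if t is t'.+1 then \sum_z P x z * kernel_pow P t' z y else (x == y)%:R.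

Definition tv_dist P pi (x : S) (t : nat) : R :=
  \big[Num.max/0]_(A : {set S})
    `| \sum_(y in A) kernel_pow P t x y - \sum_(y in A) pi y |.

(* Extended-real valued: an empty set of times t would give +oo. *)
Definition mixing_time P pi (eps : R) : \bar R :=
  \big[maxe/-oo%E]_(x : S)
    ereal_inf [set (t%:R)%:E | t in
      [set t : nat | forall t', (t <= t')%N -> tv_dist P pi x t' <= eps]].

End MixingTime.

Section Gaussian.
Context {d : measure_display} {T : measurableType d} {R : realType}.
Context {n : nat}.

Definition mutually_independent (P : probability T R)
    (w : 'I_n -> {RV P >-> R}) : Prop :=
  forall (J : {set 'I_n}) (B : 'I_n -> set R),
    (forall i, measurable (B i)) ->
    P (\bigcap_(i in [set` J]) (w i @^-1` B i)) =
    (\prod_(i in J) P (w i @^-1` B i))%E.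

(* The law N(0, I_n); normal_prob takes the mean and the standard deviation. *)
Definition standard_gaussian (P : probability T R)
    (w : 'I_n -> {RV P >-> R}) : Prop :=
  (forall i (B : set R), measurable B ->
     distribution P (w i) B = normal_prob 0 1 B) /\
  mutually_independent w.

End Gaussian.

(* Main.v *)
Require Import Defs.
From HB Require Import structures.
From mathcomp Require Import all_boot all_order all_algebra.
From mathcomp Require Import all_classical all_reals all_analysis.
From mathcomp Require Import measurable_realfun.
From mathcomp Require Import ring lra zify.

Set Implicit Arguments.
Unset Strict Implicit.
Unset Printing Implicit Defensive.

Import Order.TTheory GRing.Theory Num.Theory.
Import numFieldNormedType.Exports.

Local Open Scope ring_scope.

(** The chain is trapped near the full model. Since [X] is invertible, the full
    model fits [Y] exactly, and a model that misses some columns is penalised by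
    (1 + g (1 - R^2))^(-n/2), where [g = n^(2 alpha)] is so large that this
    factor is exponentially small unless the residual is tiny. On the other hand
    the full model weighs only about n^(-kappa n) times the empty one in spite
    of its perfect fit, and the models close to it at most e^(O(n)) times more,
    so that neighbourhood has negligible posterior mass. A chain started there
    must leave it in order to mix.

    The bottleneck is [A = {gamma : |gamma| > n - m}] with [m] about n / ln n,
    and not the full model alone: a single column may have a residual of order
    1/n, which for [alpha < 3/2] is too small to make one step improbable. Moves
    change the size of a model by at most one, so [A] can only be left through
    the level |gamma| = n - m. By [mass_retained] and [mixing_time_ge] the
    mixing time is at least about pi(A) / pi(level), and
    [posterior_mixing_time_ge] bounds this ratio below by e^n as soon as 1 + g
    (1 - R^2) exceeds a large constant on that level: the prior factors
    contribute only e^(O(m ln n)) = e^(O(n)).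

    The probabilistic part is a lower bound, uniform over the C(n, m) models of
    the level, for the residual, that is, for the projection of [Y] on a
    subspace of dimension [m]. If the projection is small, then [Y] lies in the
    slab |v . Y| <= s for every [v] of the subspace with sup norm at most one.
    Choosing vectors with a coordinate equal to 1 and conditioning on the other
    coordinates, one pivot after the other, gives probability at most (5 s)^m
    ([small_ball]); with s = m / (60 n) this beats C(n, m) <= (e n / m)^m
    ([level_union_bound]). To condition with finite sums only, the Gaussian
    coordinates are first rounded to a grid ([gaussian_not_almost_ortho]). Off
    the slabs, 1 - R^2 >= s^2 / (n L)^2 with |Y_i| <= L = O(sqrt (ln n)), so g
    (1 - R^2) is at least n^(2 alpha - 2) up to logarithms ([fit_scale_ge]), and
    it diverges because [alpha > 1].

    A probability is monotone on measurable sets only, whence the separate proof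
    that the event on the mixing time is measurable
    ([measurable_mixing_time_ge]). *)

(** * Bottlenecks of reversible chains *)

Section Bottleneck.
Context {R : realType} {S : finType}.
Variables (P : S -> S -> R) (pi : S -> R).
Hypothesis P_ge0 : forall x y, 0 <= P x y.
Hypothesis P_sum1 : forall x, \sum_y P x y = 1.
Hypothesis pi_ge0 : forall x, 0 <= pi x.
Hypothesis P_reversible : forall x y, pi x * P x y = pi y * P y x.

Lemma kernel_pow_ge0 t x y : 0 <= kernel_pow P t x y.
Proof.
elim: t x => [|t IH] x /=; first by rewrite ler0n.
by apply: sumr_ge0 => z _; apply: mulr_ge0.
Qed.

Lemma kernel_pow_sum1 t x : \sum_y kernel_pow P t x y = 1.
Proof.
elim: t x => [|t IH] x /=.
  rewrite (bigD1 x) //= eqxx big1 ?addr0 // => y /negPf yx.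
  by rewrite eq_sym yx.
rewrite exchange_big /= -[RHS](P_sum1 x); apply: eq_bigr => z _.
by rewrite -mulr_sumr IH mulr1.
Qed.

Lemma kernel_pow_set_le1 t x (A : {set S}) :
  \sum_(y in A) kernel_pow P t x y <= 1.
Proof.
rewrite -(kernel_pow_sum1 t x) [leRHS](bigID (mem A)) /= lerDl.
by apply: sumr_ge0 => z _; apply: kernel_pow_ge0.
Qed.

Variables A B : {set S}.
Hypothesis B_boundary : forall x y, x \notin A -> x \notin B -> y \in A ->
  P x y = 0.

Lemma stationary_flow_le :
  \sum_(x in A) \sum_(y in ~: A) pi x * P x y <= \sum_(y in B) pi y.
Proof.
rewrite exchange_big /=.
have -> : \sum_(y in B) pi y = \sum_(y in B) \sum_z pi y * P y z.
  by apply: eq_bigr => y _; rewrite -mulr_sumr P_sum1 mulr1.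
rewrite (bigID (mem B)) /= [X in _ + X]big1 ?addr0; last first.
  move=> y /andP[]; rewrite inE => yA yB; apply: big1 => x xA.
  by rewrite P_reversible B_boundary ?mulr0.
rewrite [leRHS](bigID (fun y => y \notin A)) /= -[leLHS]addr0.
apply: lerD; last first.
  by apply: sumr_ge0 => y _; apply: sumr_ge0 => z _; apply: mulr_ge0.
under eq_bigl => y do rewrite inE andbC.
apply: ler_sum => y _.
rewrite [leRHS](bigID (mem A)) /= -[leLHS]addr0; apply: lerD.
  by apply: ler_sum => x _; rewrite P_reversible.
by apply: sumr_ge0 => z _; apply: mulr_ge0.
Qed.

(** Each step moves at most the stationary flow out of [A], by reversibility at
    most the mass of [B], so the chain started from [pi] restricted to [A]
    loses mass at most linearly in time. *)
Lemma mass_retained t :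
  \sum_(x in A) pi x - t%:R * \sum_(y in B) pi y <=
  \sum_(x in A) pi x * \sum_(y in A) kernel_pow P t x y.
Proof.
elim: t => [|t IH].
  rewrite mul0r subr0; apply: ler_sum => x xA /=.
  rewrite (bigD1 x) //= eqxx mulrDr mulr1 lerDl mulr_ge0 //.
  by apply: sumr_ge0 => y _; rewrite ler0n.
pose h t z := \sum_(y in A) kernel_pow P t z y.
have h_ge0 z : 0 <= h t z by apply: sumr_ge0 => y _; apply: kernel_pow_ge0.
have h_le1 z : h t z <= 1 by apply: kernel_pow_set_le1.
have -> : \sum_(x in A) pi x * \sum_(y in A) kernel_pow P t.+1 x y =
    \sum_z h t z * (pi z * \sum_(x in A) P z x).
  transitivity (\sum_(x in A) \sum_z pi x * P x z * h t z).
    apply: eq_bigr => x _; rewrite exchange_big /= mulr_sumr.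
    by apply: eq_bigr => z _; rewrite -mulrA; congr (_ * _); rewrite mulr_sumr.
  rewrite exchange_big /=; apply: eq_bigr => z _.
  rewrite !mulr_sumr; apply: eq_bigr => x _.
  by rewrite P_reversible mulrC.
rewrite [leRHS](bigID (mem A)) /=; apply: ler_wpDr.
  apply: sumr_ge0 => z _; rewrite !mulr_ge0 //.
  by apply: sumr_ge0.
have -> : \sum_(z in A) h t z * (pi z * \sum_(x in A) P z x) =
    \sum_(z in A) pi z * h t z - \sum_(z in A) h t z * \sum_(x in ~: A) pi z * P z x.
  rewrite -sumrB; apply: eq_bigr => z _.
  have : \sum_(x in A) P z x = 1 - \sum_(x in ~: A) P z x.
    rewrite -(P_sum1 z) [\sum_y P z y](bigID (mem A)) /=.
    by under [X in _ - X]eq_bigl => y do rewrite inE; rewrite addrK.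
  by move=> ->; rewrite -mulr_sumr; ring.
rewrite mulrSr mulrDl mul1r opprD addrA; apply: lerB; first exact: IH.
apply: le_trans stationary_flow_le; apply: ler_sum => z _.
rewrite -[leRHS]mul1r; apply: ler_wpM2r => //.
by apply: sumr_ge0 => y _; apply: mulr_ge0.
Qed.

(** If the chain had mixed by time [t], the mass retained in [A] would be at
    most a fraction [pi A + eps] of [pi A]. *)
Lemma mixing_time_ge (eps T : R) :
  0 <= T -> 0 < \sum_(x in A) pi x ->
  T * \sum_(y in B) pi y < (1 - eps - \sum_(x in A) pi x) * \sum_(x in A) pi x ->
  (T%:E <= mixing_time P pi eps)%E.
Proof.
move=> T0 pA hT; rewrite leNgt; apply/negP => hlt.
have xlt x : (ereal_inf [set (t%:R)%:E | t in [set t : nat |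
      forall t', (t <= t')%N -> (tv_dist P pi x t' <= eps)%R]]%classic < T%:E)%E.
  by apply: le_lt_trans hlt; rewrite /mixing_time (bigD1 x) //= le_max lexx.
pose t := Num.truncn T.
have tT : t%:R <= T by rewrite truncn_le.
have tv x : tv_dist P pi x t <= eps.
  have [_ [s /= hs <-]] := ereal_inf_lt (xlt x).
  by rewrite lte_fin => sT; apply: hs; rewrite truncn_ge_nat // ltW.
have hA x : \sum_(y in A) kernel_pow P t x y <= \sum_(x in A) pi x + eps.
  rewrite -lerBlDl (le_trans (ler_norm _)) //; apply: le_trans (tv x).
  by rewrite /tv_dist (bigD1 A) //= le_max lexx.
have := mass_retained t; apply/negP; rewrite -ltNge.
have : \sum_(x in A) pi x * \sum_(y in A) kernel_pow P t x y <=
    (\sum_(x in A) pi x) * (\sum_(x in A) pi x + eps).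
  by rewrite mulr_suml; apply: ler_sum => x _; rewrite ler_wpM2l.
move=> /le_lt_trans; apply.
have : t%:R * \sum_(y in B) pi y <= T * \sum_(y in B) pi y.
  by apply: ler_wpM2r => //; apply: sumr_ge0.
move: hT; set a := \sum_(x in A) pi x; set b := \sum_(y in B) pi y.
by move=> h1 h2; have : t%:R * b < (1 - eps - a) * a by [apply: le_lt_trans h2 h1]; lra.
Qed.

End Bottleneck.

(** * The Metropolis-Hastings chain *)

Section MetropolisHastings.
Context {R : realType} {p : nat}.
Variable pi : {set 'I_p} -> R.
Hypothesis pi_gt0 : forall gamma, 0 < pi gamma.
Implicit Types gamma : {set 'I_p}.

Lemma hammingC gamma gamma' : hamming gamma gamma' = hamming gamma' gamma.
Proof. by apply: eq_card => j; rewrite !inE eq_sym. Qed.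

Lemma N1_sym gamma gamma' : N1 gamma gamma' = N1 gamma' gamma.
Proof. by rewrite /N1 hammingC. Qed.

Lemma N2P gamma gamma' :
  reflect (exists k l, [/\ k \in gamma, l \notin gamma &
             gamma' = l |: (gamma :\ k)]) (N2 gamma gamma').
Proof.
apply: (iffP existsP) => [[k /andP[kg /existsP[l /andP[]]]]|[k [l [kg lg ->]]]].
  by rewrite inE => lg /eqP ->; exists k, l.
by exists k; rewrite kg; apply/existsP; exists l; rewrite inE lg eqxx.
Qed.

Lemma card_N2 gamma gamma' : N2 gamma gamma' -> #|gamma'| = #|gamma|.
Proof.
move=> /N2P[k [l [kg lg ->]]].
rewrite cardsU1 !inE (negPf lg) andbF /= (cardsD1 k gamma) kg.
by [].
Qed.

Lemma N2_sym gamma gamma' : N2 gamma gamma' = N2 gamma' gamma.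
Proof.
suff H : forall a b : {set 'I_p}, N2 a b -> N2 b a by apply/idP/idP; apply: H.
move=> a b /N2P[k [l [kg lg ->]]]; apply/N2P; exists l, k.
have kl : k != l by apply: contraNneq lg => <-.
split; rewrite ?inE ?eqxx ?(negPf kl) //.
apply/setP => j; rewrite !inE.
case: (eqVneq j k) => [->|jk] /=; first exact: kg.
by case: (eqVneq j l) => [->|jl] //=; apply/negbTE.
Qed.

Lemma card_le_hamming gamma gamma' : (#|gamma| <= #|gamma'| + hamming gamma gamma')%N.
Proof.
rewrite /hamming -(cardsE [pred j | (j \in gamma) != (j \in gamma')]).
apply: leq_trans (leq_card_setU _ _).1; apply: subset_leq_card.
by apply/fintype.subsetP => j jg; rewrite !inE jg; case: (j \in gamma').
Qed.

Lemma MH_move_ge0 gamma gamma' : 0 <= MH_move pi gamma gamma'.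
Proof.
rewrite /MH_move; have h : 0 <= Num.min 1 (pi gamma' / pi gamma).
  by rewrite le_min ler01 divr_ge0 // ltW.
by case: ifP => _; [|case: ifP => _ //]; rewrite mulr_ge0 // invr_ge0 ?mulr_ge0.
Qed.

Lemma MH_move_reversible gamma gamma' :
  pi gamma * MH_move pi gamma gamma' = pi gamma' * MH_move pi gamma' gamma.
Proof.
have acc a b : pi a * Num.min 1 (pi b / pi a) = Num.min (pi a) (pi b).
  rewrite minr_pMr ?(ltW (pi_gt0 _)) // mulr1 mulrC divfK //.
  by rewrite gt_eqF.
rewrite /MH_move N1_sym N2_sym; case: ifP => _.
  by rewrite (mulrCA (pi gamma)) (mulrCA (pi gamma')) !acc minC.
case: ifP => [/card_N2 E|_]; last by rewrite !mulr0.
have Ec : #|~: gamma'| = #|~: gamma|.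
  by apply/eqP; rewrite -(eqn_add2l #|gamma|) {1}E !cardsC.
by rewrite (mulrCA (pi gamma)) (mulrCA (pi gamma')) !acc minC Ec E.
Qed.

(** Both halves of the proposal distribution have total mass at most one half. *)
Lemma MH_move_sum_le1 gamma :
  \sum_(gamma' | gamma' != gamma) MH_move pi gamma gamma' <= 1.
Proof.
have acc_le a : Num.min 1 (pi a / pi gamma) <= 1 by rewrite ge_min lexx.
have cnt (k m : nat) : (k <= m)%N -> (2 * m%:R : R)^-1 *+ k <= 1 / 2.
  move=> km; case: (posnP m) => [m0|m_gt0].
    by move: km; rewrite m0 leqn0 => /eqP ->; rewrite mulr0n.
  rewrite -[_ *+ k]mulr_natr invfM -mulrA [leRHS]mul1r ler_piMr ?invr_ge0 //.
  by rewrite mulrC ler_pdivrMr ?ltr0n // mul1r ler_nat.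
have h1 : \sum_(a | N1 gamma a) (2 * p%:R : R)^-1 <= 1 / 2.
  have : (#|[set a | N1 gamma a]| <= p)%N.
    suff /subset_leq_card/leq_trans : [set a | N1 gamma a] \subset
        [set [set i | (i \in gamma) (+) (i == j)] | j in [set: 'I_p]].
      by apply; rewrite (leq_trans (leq_imset_card _ _)) // cardsT card_ord.
    apply/fintype.subsetP => a; rewrite inE /N1 /hamming => /eqP.
    rewrite -(cardsE [pred j | (j \in a) != (j \in gamma)]) => /eqP.
    move=> /cards1P[j ej]; apply/imsetP; exists j => //.
    apply/setP => i; rewrite inE; move/setP/(_ i): ej; rewrite !inE.
    by case: (i \in a); case: (i \in gamma); case: (i == j).
  by rewrite cardsE sumr_const => /cnt.
have h2 : \sum_(a | N2 gamma a) (2 * #|gamma|%:R * #|~: gamma|%:R : R)^-1 <= 1 / 2.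
  have : (#|[set a | N2 gamma a]| <= #|gamma| * #|~: gamma|)%N.
    suff /subset_leq_card/leq_trans : [set a | N2 gamma a] \subset
        (fun u : 'I_p * 'I_p => u.2 |: (gamma :\ u.1))
          @: finset.setX gamma (~: gamma).
      by apply; rewrite (leq_trans (leq_imset_card _ _)) // cardsX.
    apply/fintype.subsetP => a; rewrite inE => /N2P[k [l [kg lg ->]]].
    by apply/imsetP; exists (k, l) => //=; rewrite !inE kg lg.
  by rewrite cardsE sumr_const -mulrA -natrM => /cnt.
have -> : (1 : R) = 1 / 2 + 1 / 2 by field.
apply: le_trans (lerD h1 h2).
rewrite big_mkcond [X in _ <= X + _]big_mkcond [X in _ <= _ + X]big_mkcond -big_split.
apply: ler_sum => a _ /=; rewrite /MH_move.
have ge0_1 : 0 <= (2 * p%:R : R)^-1 by rewrite invr_ge0 mulr_ge0.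
have ge0_2 : 0 <= (2 * #|gamma|%:R * #|~: gamma|%:R : R)^-1.
  by rewrite invr_ge0 !mulr_ge0.
case: (a != gamma); last by rewrite addr_ge0 //; case: ifP.
case: (N1 gamma a).
  by apply: ler_wpDr; [case: ifP|rewrite ler_piMr].
by case: ifP => _; rewrite add0r // ler_piMr.
Qed.

Lemma P_MH_ge0 gamma gamma' : 0 <= P_MH pi gamma gamma'.
Proof.
rewrite /P_MH; case: ifP => _; last exact: MH_move_ge0.
by rewrite subr_ge0 MH_move_sum_le1.
Qed.

Lemma P_MH_sum1 gamma : \sum_gamma' P_MH pi gamma gamma' = 1.
Proof.
rewrite (bigD1 gamma) //= {1}/P_MH eqxx.
rewrite [X in _ + X](eq_bigr (MH_move pi gamma)) ?subrK // => a /negPf ag.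
by rewrite /P_MH ag.
Qed.

Lemma P_MH_reversible gamma gamma' :
  pi gamma * P_MH pi gamma gamma' = pi gamma' * P_MH pi gamma' gamma.
Proof.
rewrite /P_MH eq_sym; case: eqP => [-> //|_]; exact: MH_move_reversible.
Qed.

(** A single flip changes the size by one and a swap preserves it, so a set of
    models defined by a size threshold can only be left through the next level. *)
Lemma P_MH_level k gamma gamma' :
  (#|gamma| < k)%N -> (k < #|gamma'|)%N -> P_MH pi gamma gamma' = 0.
Proof.
move=> lt1 lt2; have lt3 := ltn_trans lt1 lt2.
rewrite /P_MH; case: eqP => [e|_]; first by rewrite e ltnn in lt3.
rewrite /MH_move; case: ifP => [/eqP h|_].
  have := card_le_hamming gamma' gamma; rewrite h addn1 => /leq_ltn_trans.
  by move=> /(_ k.+1); rewrite ltnS => /(_ lt1); rewrite ltnS leqNgt lt2.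
by case: ifP => // /card_N2 e; rewrite e ltnn in lt3.
Qed.

End MetropolisHastings.

(** * Residuals of orthogonal projections *)

Section Projection.
Context {R : realType}.

Lemma cauchy_schwarz_sum (I : finType) (a b : I -> R) :
  (\sum_i a i * b i) ^+ 2 <= (\sum_i a i ^+ 2) * (\sum_i b i ^+ 2).
Proof.
set A := \sum_i a i ^+ 2; set B := \sum_i b i ^+ 2; set C := \sum_i a i * b i.
have B0 : 0 <= B by apply: sumr_ge0 => i _; apply: sqr_ge0.
have : 0 <= \sum_i (B * a i - C * b i) ^+ 2.
  by apply: sumr_ge0 => i _; apply: sqr_ge0.
have -> : \sum_i (B * a i - C * b i) ^+ 2 = B * (A * B - C ^+ 2).
  transitivity (\sum_i B ^+ 2 * a i ^+ 2 - \sum_i (2 * B * C) * (a i * b i)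
      + \sum_i C ^+ 2 * b i ^+ 2).
    by rewrite -sumrB -big_split /=; apply: eq_bigr => i _; ring.
  by rewrite -!mulr_sumr -/A -/B -/C; ring.
move: B0; rewrite le_eqVlt => /predU1P[B0 _|B0]; last first.
  by rewrite pmulr_rge0 // subr_ge0.
suff -> : C = 0 by rewrite expr0n /= -B0 mulr0.
apply: big1 => i _; move/esym/eqP: B0.
rewrite psumr_eq0 => [/allP h|j _]; last exact: sqr_ge0.
by have := h i (mem_index_enum i); rewrite /= sqrf_eq0 => /eqP ->; rewrite mulr0.
Qed.

Context {n : nat}.
Implicit Types (u v : 'rV[R]_n) (U : 'M[R]_n) (Y : 'cV[R]_n).

Lemma dotE u v : (u *m v^T) 0 0 = \sum_i u 0 i * v 0 i.
Proof. by rewrite mxE; apply: eq_bigr => i _; rewrite mxE. Qed.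

Lemma sqnormE u : (u *m u^T) 0 0 = \sum_i u 0 i ^+ 2.
Proof. by rewrite dotE; apply: eq_bigr => i _; rewrite expr2. Qed.

Lemma sqnorm_ge0 u : 0 <= (u *m u^T) 0 0.
Proof. by rewrite sqnormE; apply: sumr_ge0 => i _; rewrite sqr_ge0. Qed.

Lemma sqnorm_eq0 u : (u *m u^T) 0 0 = 0 -> u = 0.
Proof.
rewrite sqnormE => /eqP; rewrite psumr_eq0 => [/allP h|i _]; last exact: sqr_ge0.
apply/rowP => i; have := h i (mem_index_enum i).
by rewrite /= sqrf_eq0 mxE => /eqP.
Qed.

Lemma dot_eq0 U u v : (u <= U)%MS -> (v <= kermx U^T)%MS -> u *m v^T = 0.
Proof.
move=> /submxP[D ->] /sub_kermxP h.
by rewrite -mulmxA -[U]trmxK -trmx_mul h trmx0 mulmx0.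
Qed.

Lemma capmx_ortho U : (U :&: kermx U^T = 0)%MS.
Proof.
apply/eqP; rewrite -submx0; apply/rV_subP => u; rewrite sub_capmx => /andP[h1 h2].
by rewrite submx0; apply/eqP/sqnorm_eq0; rewrite (dot_eq0 h1 h2) mxE.
Qed.

Lemma addsmx_ortho U m (W : 'M[R]_(m, n)) : (W <= U + kermx U^T)%MS.
Proof.
apply: submx_full; rewrite /row_full mxrank_disjoint_sum; last exact: capmx_ortho.
by rewrite mxrank_ker mxrank_tr subnKC // rank_leq_row.
Qed.

Context {p : nat}.
Implicit Types (X : 'M[R]_(n, p)) (gamma : {set 'I_p}).

Definition residual X Y gamma : 'rV[R]_n :=
  Y^T - Y^T *m proj_mx (col_span X gamma) (kermx (col_span X gamma)^T).

Lemma residual_sub X Y gamma :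
  (residual X Y gamma <= kermx (col_span X gamma)^T)%MS.
Proof. by apply: proj_mx_compl_sub; apply: addsmx_ortho. Qed.

Lemma Phi_quadratic X Y gamma :
  (Y^T *m Phi X gamma *m Y) 0 0 =
  \sum_i Y i 0 ^+ 2 - (residual X Y gamma *m (residual X Y gamma)^T) 0 0 /\
  0 <= (Y^T *m Phi X gamma *m Y) 0 0.
Proof.
pose a := Y^T *m proj_mx (col_span X gamma) (kermx (col_span X gamma)^T).
pose r := residual X Y gamma.
have aU : (a <= col_span X gamma)%MS by apply: proj_mx_sub.
have ar : a *m r^T = 0 by apply: dot_eq0 aU (residual_sub _ _ _).
have ra : r *m a^T = 0 by rewrite -[r]trmxK -trmx_mul ar trmx0.
have eY : Y^T = a + r by rewrite /r /residual addrC subrK.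
have -> : Y^T *m Phi X gamma *m Y = a *m a^T.
  have -> : Y^T *m Phi X gamma *m Y = Y^T *m a^T.
    by rewrite -mulmxA /a trmx_mul trmxK.
  by rewrite eY mulmxDl ra addr0.
split; last exact: sqnorm_ge0.
have -> : \sum_i Y i 0 ^+ 2 = (Y^T *m Y^T^T) 0 0.
  by rewrite sqnormE; apply: eq_bigr => i _; rewrite mxE.
by rewrite eY -/r linearD /= mulmxDl !mulmxDr ar ra addr0 add0r
  [X in _ = X - _]mxE addrK.
Qed.

Lemma Rsq_ge0 X Y gamma : 0 <= Rsq X Y gamma.
Proof.
apply: divr_ge0; first by case: (Phi_quadratic X Y gamma).
by apply: sumr_ge0 => i _; apply: sqr_ge0.
Qed.

Lemma Rsq_le1 X Y gamma : Rsq X Y gamma <= 1.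
Proof.
rewrite /Rsq (Phi_quadratic X Y gamma).1.
have : 0 <= \sum_i Y i 0 ^+ 2 by apply: sumr_ge0 => i _; apply: sqr_ge0.
rewrite le_eqVlt => /predU1P[<-|h]; first by rewrite invr0 mulr0 ler01.
by rewrite ler_pdivrMr // mul1r gerBl sqnorm_ge0.
Qed.

(** Every direction orthogonal to the selected columns gives a lower bound on
    the unexplained part of [Y]. *)
Lemma Rsq_residual_ge X Y gamma v : 0 < \sum_i Y i 0 ^+ 2 ->
  (v <= kermx (col_span X gamma)^T)%MS ->
  (v *m Y) 0 0 ^+ 2 <=
  (\sum_i v 0 i ^+ 2) * ((1 - Rsq X Y gamma) * \sum_i Y i 0 ^+ 2).
Proof.
move=> Y0 vK; set r := residual X Y gamma.
have -> : (1 - Rsq X Y gamma) * \sum_i Y i 0 ^+ 2 = (r *m r^T) 0 0.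
  rewrite mulrBl mul1r /Rsq divfK ?gt_eqF // (Phi_quadratic X Y gamma).1.
  by rewrite opprB addrCA subrr addr0.
have -> : v *m Y = v *m r^T.
  rewrite /r /residual linearB /= trmxK mulmxBr.
  set a := Y^T *m _.
  have aU : (a <= col_span X gamma)%MS by apply: proj_mx_sub.
  by rewrite -[v in _ - v *m _]trmxK -trmx_mul (dot_eq0 aU vK) trmx0 subr0.
by rewrite dotE sqnormE; apply: cauchy_schwarz_sum.
Qed.

Lemma rank_kermx_col_span X gamma :
  (n - #|gamma| <= \rank (kermx (col_span X gamma)^T))%N.
Proof.
rewrite mxrank_ker mxrank_tr leq_sub2l // /col_span.
rewrite -sum1_card; apply: leq_trans (mxrank_sum_leqif _).1 _.
apply: leq_sum => j _ /=; rewrite mxrank_gen; exact: rank_leq_row.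
Qed.

End Projection.

Lemma Rsq_full (R : realType) n (X : 'M[R]_n) (Y : 'cV[R]_n) :
  X \in unitmx -> 0 < \sum_i Y i 0 ^+ 2 -> Rsq X Y [set: 'I_n] = 1.
Proof.
move=> Xu Y0; rewrite /Rsq (Phi_quadratic X Y _).1.
have full : row_full (col_span X [set: 'I_n]).
  have XT : (1%:M <= X^T)%MS by rewrite sub1mx row_full_unit unitmx_tr.
  rewrite -sub1mx; apply: submx_trans XT _; apply/row_subP => j; rewrite -tr_col.
  by apply: (sumsmx_sup j); rewrite ?genmxE ?inE.
have -> : residual X Y [set: 'I_n] = 0.
  by rewrite /residual proj_mx_id ?subrr //; [exact: capmx_ortho|exact: submx_full].
by rewrite mul0mx mxE subr0 divff // gt_eqF.
Qed.

(** * The bottleneck around the full model *)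

Section PosteriorBottleneck.
Context {R : realType} {n : nat}.
Variables (kappa g : R) (X : 'M[R]_n) (Y : 'cV[R]_n).
Hypotheses (n_gt0 : (0 < n)%N) (g_ge0 : 0 <= g).

Implicit Types gamma : {set 'I_n}.

Let W := posterior_weight kappa g X Y.

(** At equal fit, each further variable multiplies the posterior weight by
    exp(- log_cost). *)
Definition log_cost : R := kappa * ln n%:R + ln (1 + g) / 2.

Lemma fit_ge1 gamma : 1 <= 1 + g * (1 - Rsq X Y gamma).
Proof. by rewrite lerDl mulr_ge0 // subr_ge0 Rsq_le1. Qed.

Lemma posterior_weightE gamma : W gamma =
  expR (- (#|gamma|%:R * log_cost)) / (1 + g * (1 - Rsq X Y gamma)) `^ (n%:R / 2).
Proof.
rewrite /W /posterior_weight mulrA; congr (_ / _).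
rewrite /powR pnatr_eq0 eqn0Ngt n_gt0 /= gt_eqF; last by have := g_ge0; lra.
by rewrite -expRD /log_cost; congr expR; ring.
Qed.

Lemma posterior_weight_gt0 gamma : 0 < W gamma.
Proof.
rewrite posterior_weightE divr_gt0 ?expR_gt0 // powR_gt0 //.
by apply: lt_le_trans (fit_ge1 _).
Qed.

Lemma posterior_weight_sum_gt0 : 0 < \sum_gamma W gamma.
Proof.
rewrite (bigD1 finset.set0) //= ltr_wpDr ?posterior_weight_gt0 //.
by apply: sumr_ge0 => a _; apply/ltW/posterior_weight_gt0.
Qed.

Lemma posterior_gt0 gamma : 0 < posterior kappa g X Y gamma.
Proof. by rewrite divr_gt0 ?posterior_weight_gt0 ?posterior_weight_sum_gt0. Qed.

Lemma posterior_weight_le gamma (k : nat) (b : R) : 0 <= log_cost ->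
  (k <= #|gamma|)%N -> expR b <= 1 + g * (1 - Rsq X Y gamma) ->
  W gamma <= expR (- (k%:R * log_cost) - b * (n%:R / 2)).
Proof.
move=> c0 hk hb; rewrite posterior_weightE expRD.
rewrite ler_pM ?expR_ge0 ?invr_ge0 ?powR_ge0 //.
  by rewrite ler_expR lerN2 ler_wpM2r // ler_nat.
rewrite expRN lef_pV2 ?posrE ?powR_gt0 ?expR_gt0 //; last first.
  by apply: lt_le_trans (fit_ge1 _).
have -> : expR (b * (n%:R / 2)) = expR b `^ (n%:R / 2).
  by rewrite /powR gt_eqF ?expR_gt0 // expRK mulrC.
by rewrite ge0_ler_powR ?nnegrE ?expR_ge0 // (le_trans ler01 (fit_ge1 _)).
Qed.

Lemma posterior_weight_set0_ge : expR (- (n%:R / 2 * ln (1 + g))) <= W finset.set0.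
Proof.
rewrite posterior_weightE cards0 mul0r oppr0 expR0 mul1r expRN.
have u0 : 0 < 1 + g by have := g_ge0; lra.
have f0 : 0 < 1 + g * (1 - Rsq X Y finset.set0).
  by apply: lt_le_trans (fit_ge1 _).
have -> : expR (n%:R / 2 * ln (1 + g)) = (1 + g) `^ (n%:R / 2).
  by rewrite /powR gt_eqF.
rewrite lef_pV2 ?posrE ?powR_gt0 // ge0_ler_powR ?nnegrE ?(ltW f0) ?(ltW u0) //.
by rewrite lerD2l ler_piMr // gerBl Rsq_ge0.
Qed.

Lemma sum_subsets_le (Q : pred {set 'I_n}) (F : {set 'I_n} -> R) (b : R) :
  (forall gamma, Q gamma -> F gamma <= expR b) ->
  \sum_(gamma | Q gamma) F gamma <= expR (n%:R + b).
Proof.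
move=> hF; apply: le_trans (ler_sum _ hF) _.
rewrite sumr_const -[_ *+ _]mulr_natl expRD ler_wpM2r ?expR_ge0 //.
apply: (@le_trans _ _ (2 ^ n)%:R).
  rewrite ler_nat; apply: leq_trans (max_card _) _.
  by rewrite -cardsT -powersetT card_powerset cardsT card_ord.
rewrite natrX -[n%:R]mulr_natl mulr1 -[X in expR X]mul1r mulrC expRM_natl.
by rewrite lerXn2r ?nnegrE ?expR_ge0 //; have := expR_ge1Dx (1 : R); lra.
Qed.

(** The models with more than [n - m] variables form the bottleneck. Dropping [m]
    variables from the full model, whose fit is perfect, gains the factor
    [expR (m%:R * log_cost)], but at level [n - m] the fit term costs at least
    [expR ((c + 2) * n%:R)]; so the boundary has at most [expR (- n%:R)] times
    the mass of the full model. Compared with the empty model, each of the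
    variables of the full model costs [kappa * ln n] net of the worst possible
    fit, so the bottleneck itself has small mass. *)
Lemma posterior_mixing_time_ge (m : nat) (c eps : R) :
  X \in unitmx -> 0 < \sum_i Y i 0 ^+ 2 -> 0 <= kappa -> eps < 1 / 2 ->
  (4 <= n)%N -> (0 < m)%N -> (m <= n)%N ->
  m%:R * log_cost <= c * n%:R -> c + 2 <= kappa * ln n%:R ->
  (forall gamma : {set 'I_n}, #|gamma| = (n - m)%N ->
     expR (2 * (c + 2)) <= 1 + g * (1 - Rsq X Y gamma)) ->
  ((expR (1 / 2 * n%:R))%:E <=
     mixing_time (P_MH (posterior kappa g X Y)) (posterior kappa g X Y) eps)%E.
Proof.
move=> Xu Y0 kappa0 eps_lt n4 m0 mn hm hk hB.
pose pi := posterior kappa g X Y.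
pose A := [set gamma : {set 'I_n} | (n - m < #|gamma|)%N].
pose B := [set gamma : {set 'I_n} | #|gamma| == (n - m)%N].
have pi_gt0 gamma : 0 < pi gamma := posterior_gt0 gamma.
have cost0 : 0 <= log_cost.
  by rewrite addr_ge0 ?mulr_ge0 ?ln_ge0 ?ler1n ?lerDl.
have fullA : [set: 'I_n] \in A by rewrite inE cardsT card_ord ltn_subrL m0.
pose Z := \sum_gamma W gamma.
have Z0 : 0 < Z by exact: posterior_weight_sum_gt0.
have sumpi (Q : pred {set 'I_n}) :
    \sum_(gamma | Q gamma) pi gamma = (\sum_(gamma | Q gamma) W gamma) / Z.
  by rewrite mulr_suml.
have n_m : (n - m)%:R = n%:R - m%:R :> R by rewrite natrB.
have W_full : W [set: 'I_n] = expR (- (n%:R * log_cost)).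
  rewrite posterior_weightE Rsq_full // subrr mulr0 addr0 powR1 divr1.
  by rewrite cardsT card_ord.
(* The sum over a level has at most 2 ^ n <= expR n terms. *)
have piB : \sum_(gamma in B) pi gamma <= expR (- n%:R) * pi [set: 'I_n].
  rewrite sumpi /pi /posterior -/W -/Z mulrA ler_wpM2r ?invr_ge0 ?(ltW Z0) //.
  rewrite W_full -expRD.
  apply: (@le_trans _ _ (expR (n%:R + (- ((n - m)%:R * log_cost)
      - 2 * (c + 2) * (n%:R / 2))))).
    apply: sum_subsets_le => gamma; rewrite inE => /eqP e.
    by apply: posterior_weight_le; rewrite ?e // hB.
  rewrite ler_expR n_m; move: hm; set l := log_cost; move: n%:R m%:R => x y.
  by move=> hm; lra.
(* Inside the bottleneck the fit term is only bounded below by 1 = expR 0. *)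
have piA : \sum_(gamma in A) pi gamma <= expR (- n%:R).
  rewrite sumpi ler_pdivrMr //.
  apply: (@le_trans _ _ (expR (- n%:R) * W finset.set0)); last first.
    rewrite ler_wpM2l ?expR_ge0 // /Z (bigD1 finset.set0) //= lerDl.
    by apply: sumr_ge0 => a _; apply/ltW/posterior_weight_gt0.
  apply: le_trans (ler_wpM2l (expR_ge0 _) posterior_weight_set0_ge).
  rewrite -expRD.
  apply: (@le_trans _ _ (expR (n%:R + (- ((n - m)%:R * log_cost)
      - 0 * (n%:R / 2))))).
    apply: sum_subsets_le => gamma; rewrite inE => lt.
    by apply: posterior_weight_le => //; [exact: ltnW|rewrite expR0 fit_ge1].
  rewrite ler_expR n_m mulrBl.
  have : n%:R * (c + 2) <= n%:R * (kappa * ln n%:R) by rewrite ler_wpM2l.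
  move: hm; rewrite /log_cost.
  move: n%:R m%:R (ln n%:R) (ln (1 + g)) => x y u v hm hx.
  have -> : x * (kappa * u + v / 2) = x * (kappa * u) + x / 2 * v by ring.
  by lra.
have piA0 : 0 < \sum_(gamma in A) pi gamma.
  rewrite (bigD1 _ fullA) /= ltr_wpDr //.
  by apply: sumr_ge0 => a _; apply/ltW.
have full_le : pi [set: 'I_n] <= \sum_(gamma in A) pi gamma.
  by rewrite (bigD1 _ fullA) /= lerDl; apply: sumr_ge0 => a _; apply/ltW.
have boundary gamma gamma' : gamma \notin A -> gamma \notin B -> gamma' \in A ->
    P_MH pi gamma gamma' = 0.
  rewrite !inE -leqNgt leq_eqVlt => /orP[->//|lt] _ lt'.
  exact: P_MH_level lt lt'.
apply: (mixing_time_ge (P_MH_ge0 pi_gt0) (P_MH_sum1 pi) (fun a => ltW (pi_gt0 a))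
  (P_MH_reversible pi_gt0) boundary (expR_ge0 _) piA0).
have e4 : expR (- (1 / 2 * n%:R)) <= 1 / 4 :> R.
  apply: (@le_trans _ _ (expR (- (1 + 1)))).
    have : 4 <= n%:R :> R by rewrite ler_nat.
    by rewrite ler_expR; lra.
  rewrite expRN expRD mul1r lef_pV2 ?posrE ?mulr_gt0 ?expR_gt0 //.
  have := expR_ge1Dx (1 : R) => h; have -> : (4 : R) = 2 * 2 by lra.
  by rewrite ler_pM //; lra.
apply: (@le_lt_trans _ _ (expR (- (1 / 2 * n%:R)) * \sum_(gamma in A) pi gamma)).
  apply: (@le_trans _ _ (expR (1 / 2 * n%:R) * (expR (- n%:R) * pi [set: 'I_n]))).
    by rewrite ler_wpM2l ?expR_ge0.
  rewrite mulrA -expRD.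
  have -> : 1 / 2 * n%:R + - n%:R = - (1 / 2 * n%:R) :> R by field.
  by rewrite ler_wpM2l ?expR_ge0.
rewrite ltr_pM2r //.
have : expR (- n%:R) <= expR (- (1 / 2 * n%:R)) :> R.
  by rewrite ler_expR lerN2; have : 0 <= n%:R :> R by []; lra.
by move: piA; lra.
Qed.

End PosteriorBottleneck.

(** * A small ball estimate for discrete product laws *)

Section SmallBall.
Context {R : realType} {I : finType} {n : nat}.
Variables (q rep : I -> R).
Hypothesis q_ge0 : forall a, 0 <= q a.
Hypothesis q_sum1 : \sum_a q a = 1.
Implicit Types (k : {ffun 'I_n -> I}) (V : 'M[R]_n).

Definition prod_law k : R := \prod_i q (k i).

Definition upd k (j : 'I_n) (a : I) : {ffun 'I_n -> I} :=
  [ffun i => if i == j then a else k i].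

Lemma prod_law_ge0 k : 0 <= prod_law k.
Proof. by apply: prodr_ge0. Qed.

Lemma prod_law_sum1 : \sum_k prod_law k = 1.
Proof.
rewrite -(bigA_distr_bigA (fun (i : 'I_n) a => q a)) /=.
by apply: big1 => i _; exact: q_sum1.
Qed.

(** Redrawing one coordinate independently does not change the law. *)
Lemma resample (F : {ffun 'I_n -> I} -> R) j :
  \sum_k prod_law k * F k =
  \sum_k prod_law k * \sum_a q a * F (upd k j a).
Proof.
pose sw (u : {ffun 'I_n -> I} * I) := (upd u.1 j u.2, u.1 j).
have swK : involutive sw.
  move=> [k a]; rewrite /sw /=; congr (_, _); last by rewrite ffunE eqxx.
  by apply/ffunP => i; rewrite !ffunE; case: eqP => [->|].
transitivity (\sum_u prod_law u.1 * q u.2 * F u.1).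
  rewrite -(pair_bigA _ (fun k a => prod_law k * q a * F k)) /=.
  apply: eq_bigr => k _; rewrite -mulr_suml -mulr_sumr q_sum1 mulr1.
  by [].
rewrite (reindex_inj (inv_inj swK)) /=.
transitivity (\sum_u prod_law u.1 * q u.2 * F (upd u.1 j u.2)).
  apply: eq_bigr => -[k a] _ /=; congr (_ * _).
  rewrite /prod_law (bigD1 j) // [in RHS](bigD1 j) //= ffunE eqxx.
  rewrite (eq_bigr (fun i => q (k i))) => [|i /negPf ij]; last by rewrite ffunE ij.
  by ring.
rewrite -(pair_bigA _ (fun k a => prod_law k * q a * F (upd k j a))) /=.
by apply: eq_bigr => k _; rewrite mulr_sumr; apply: eq_bigr => a _; rewrite mulrA.
Qed.

Variable s : R.

Definition almost_ortho V k : bool :=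
  `[< forall v : 'rV[R]_n, (v <= V)%MS -> (forall i, `|v 0 i| <= 1) ->
      `|\sum_i v 0 i * rep (k i)| <= s >].

Lemma exists_pivot V : (0 < \rank V)%N ->
  exists (v : 'rV[R]_n) (j : 'I_n),
    [/\ (v <= V)%MS, v 0 j = 1 & forall i, `|v 0 i| <= 1].
Proof.
rewrite lt0n mxrank_eq0 => /rowV0Pn[u uV u0].
have [j0 uj0] : exists j, u 0 j != 0 by apply/rV0Pn.
pose j := [arg max_(i > j0) `|u 0 i|]%O.
have ujmax i : `|u 0 i| <= `|u 0 j|.
  by rewrite /j; case: Order.TotalTheory.arg_maxP => // x _; apply.
have uj : u 0 j != 0.
  by rewrite -normr_gt0 (lt_le_trans _ (ujmax j0)) // normr_gt0.
exists ((u 0 j)^-1 *: u), j; split; first exact: scalemx_sub.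
  by rewrite mxE mulVf.
by move=> i; rewrite mxE normrM normfV ler_pdivrMl ?normr_gt0 // mulr1.
Qed.

Definition coord_hyperplane V (j : 'I_n) : 'M[R]_n :=
  (V :&: kermx (delta_mx j 0%R : 'cV[R]_n))%MS.

Lemma coord_hyperplaneP V j (v : 'rV[R]_n) :
  (v <= coord_hyperplane V j)%MS -> (v <= V)%MS /\ v 0 j = 0.
Proof.
rewrite sub_capmx => /andP[vV /sub_kermxP h]; split=> //.
by move/matrixP/(_ 0 0): h; rewrite -colE !mxE.
Qed.

Lemma rank_coord_hyperplane V j : (\rank V <= (\rank (coord_hyperplane V j)).+1)%N.
Proof.
have n0 : (0 < n)%N by apply: leq_ltn_trans (ltn_ord j).
have := mxrank_sum_cap V (kermx (delta_mx j 0%R : 'cV[R]_n)).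
have : (n.-1 <= \rank (kermx (delta_mx j 0%R : 'cV[R]_n)))%N.
  by rewrite mxrank_ker -subn1 leq_sub2l // rank_leq_col.
have := rank_leq_col (V + kermx (delta_mx j 0%R : 'cV[R]_n))%MS.
rewrite -/(coord_hyperplane V j).
move: (\rank _) (\rank (coord_hyperplane V j)) (\rank V) (\rank _) => a b c e.
by lia.
Qed.

(** Along a direction of [V] with a largest coordinate [v 0 j = 1], the law of
    coordinate [j] gives a factor [delta]; the vectors of [V] vanishing at [j]
    do not see that coordinate, so the argument repeats on them. *)
Lemma small_ball (delta : R) (m : nat) V :
  (forall z, \sum_(a | `|rep a + z| <= s) q a <= delta) ->
  (m <= \rank V)%N ->
  \sum_(k | almost_ortho V k) prod_law k <= delta ^+ m.
Proof.
move=> hdelta.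
have delta_ge0 : 0 <= delta.
  by apply: le_trans (hdelta 0); apply: sumr_ge0.
elim: m V => [|m IH] V hm.
  rewrite expr0 -prod_law_sum1 [leRHS](bigID (almost_ortho V)) /= lerDl.
  by apply: sumr_ge0 => k _; exact: prod_law_ge0.
have [v [j [vV vj v1]]] := exists_pivot (leq_trans (ltn0Sn _) hm).
pose V' := coord_hyperplane V j.
have rV' : (m <= \rank V')%N.
  by rewrite -ltnS (leq_trans hm) // rank_coord_hyperplane.
have indep k a : almost_ortho V' (upd k j a) = almost_ortho V' k.
  have E (u : 'rV[R]_n) : (u <= V')%MS ->
      \sum_i u 0 i * rep (upd k j a i) = \sum_i u 0 i * rep (k i).
    move=> /coord_hyperplaneP[_ uj]; apply: eq_bigr => i _; rewrite ffunE.
    by case: eqP => [->|//]; rewrite uj !mul0r.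
  by apply/asboolP/asboolP => h u uV' u1; have := h u uV' u1; rewrite E.
pose S k := `|\sum_i v 0 i * rep (k i)| <= s.
have -> : delta ^+ m.+1 = delta * delta ^+ m by rewrite exprS.
apply: (@le_trans _ _ (\sum_k prod_law k * ((S k)%:R * (almost_ortho V' k)%:R))).
  rewrite big_mkcond /=; apply: ler_sum => k _; case: ifP => [/asboolP h|_].
    have -> : S k by apply: h.
    have -> : almost_ortho V' k.
      by apply/asboolP => u /coord_hyperplaneP[uV _]; apply: h.
    by rewrite !mulr1.
  by rewrite !mulr_ge0 ?ler0n ?prod_law_ge0.
rewrite (resample _ j).
apply: le_trans (ler_wpM2l delta_ge0 (IH V' rV')).
rewrite [X in _ <= _ * X]big_mkcond mulr_sumr; apply: ler_sum => k _ /=.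
under eq_bigr => a _ do rewrite indep mulrA.
rewrite -mulr_suml; case: (almost_ortho V' k); last by rewrite !mulr0.
rewrite mulr1 mulrC ler_wpM2r ?prod_law_ge0 //.
pose z := \sum_(i | i != j) v 0 i * rep (k i).
apply: le_trans (hdelta z); rewrite [leRHS]big_mkcond; apply: ler_sum => a _.
have -> : S (upd k j a) = (`|rep a + z| <= s).
  rewrite /S (bigD1 j) //= ffunE eqxx vj mul1r; congr (`|_ + _| <= _).
  by apply: eq_bigr => i /negPf ij; rewrite ffunE ij.
by case: ifP => _; rewrite ?mulr1 ?mulr0.
Qed.

End SmallBall.

(** * Union bound over the boundary level *)

Lemma expR1_le4 (R : realType) : expR 1 <= 4 :> R.
Proof.
have h := expR_ge1Dx (- (1 / 2) : R).
have e2 : expR (1 / 2) <= 2 :> R.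
  rewrite -[expR _]invrK -expRN -[X in _ <= X]invrK lef_pV2 ?posrE ?expR_gt0 //.
  by apply: le_trans h; lra.
have -> : expR 1 = expR (1 / 2) * expR (1 / 2) :> R.
  by rewrite -expRD; congr expR; field.
have -> : (4 : R) = 2 * 2 by lra.
by rewrite ler_pM ?expR_ge0.
Qed.

Lemma ffact_le_exp n m : (n ^_ m <= n ^ m)%N.
Proof.
elim: m n => [|m IH] n //; rewrite ffactnS expnS leq_mul2l.
apply/orP; right; apply: leq_trans (IH _) _.
by case: m {IH} => // m; rewrite leq_exp2r // leq_pred.
Qed.

(** C(n, m) <= n^m / m! <= (e n / m)^m, so a small ball probability of order
    (m / (12 n))^m survives the union bound. *)
Lemma level_union_bound (R : realType) n m : (1 < m)%N -> (m <= n)%N ->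
  #|[set gamma : {set 'I_n} | #|gamma| == (n - m)%N]|%:R
    * (m%:R / (12 * n%:R)) ^+ m <= 1 / 4 :> R.
Proof.
move=> m1 mn; have m0 := ltnW m1; rewrite card_draws card_ord bin_sub //.
have n0 : 0 < n%:R :> R by rewrite ltr0n (leq_trans m0).
have f0 : 0 < m`!%:R :> R by rewrite ltr0n fact_gt0.
have hC : ('C(n, m))%:R <= n%:R ^+ m / m`!%:R :> R.
  by rewrite ler_pdivlMr // -natrM bin_ffact -natrX ler_nat ffact_le_exp.
have hm : m%:R ^+ m / m`!%:R <= 4 ^+ m :> R.
  apply: (@le_trans _ _ (expR m%:R)).
    case: m m0 {m1 mn f0 hC} => // m _.
    by apply: le_trans (expR_ge1Dxn m (ler0n R m.+1)); rewrite lerDr.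
  rewrite -[X in expR X]mulr1 expRM_natl.
  by rewrite lerXn2r ?nnegrE ?expR_ge0 // expR1_le4.
apply: (@le_trans _ _ (n%:R ^+ m / m`!%:R * (m%:R / (12 * n%:R)) ^+ m)).
  by rewrite ler_wpM2r // exprn_ge0 // divr_ge0 ?mulr_ge0 // ltW.
have -> : n%:R ^+ m / m`!%:R * (m%:R / (12 * n%:R)) ^+ m =
    (m%:R ^+ m / m`!%:R) * (12^-1) ^+ m :> R.
  rewrite !exprMn !exprVn exprMn; field.
  by rewrite !expf_neq0 ?gt_eqF.
apply: (@le_trans _ _ (4 ^+ m * 12^-1 ^+ m)).
  by rewrite ler_wpM2r // exprn_ge0 // invr_ge0.
rewrite -exprMn; apply: (@le_trans _ _ ((4 * 12^-1) ^+ 2)).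
  by rewrite ler_wiXn2l //; lra.
by rewrite expr2; lra.
Qed.

Local Open Scope classical_set_scope.

(** * Measurability of the mixing time *)

Section Measurability.
Context {d : measure_display} {T : measurableType d} {R : realType}.

Lemma measurable_fun_bigmax (I : Type) (s : seq I) (f : I -> T -> R) :
  (forall i, measurable_fun setT (f i)) ->
  measurable_fun setT (fun t => \big[Num.max/0]_(i <- s) f i t).
Proof.
move=> mf; elim: s => [|i s IH].
  by under eq_fun do rewrite big_nil; exact: measurable_cst.
by under eq_fun do rewrite big_cons; apply: measurable_maxr.
Qed.

Lemma measurable_fun_sumP (I : Type) (s : seq I) (p : pred I) (f : I -> T -> R) :
  (forall i, measurable_fun setT (f i)) ->
  measurable_fun setT (fun t => \sum_(i <- s | p i) f i t).
Proof.
move=> mf; under eq_fun do rewrite big_mkcond /=.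
by apply: measurable_sum => i; case: (p i) => //; exact: measurable_cst.
Qed.

Lemma measurable_fun_invr_ge0 (f : T -> R) : (forall t, 0 <= f t) ->
  measurable_fun setT f -> measurable_fun setT (fun t => (f t)^-1).
Proof.
move=> f0 mf; under eq_fun do rewrite -powR_inv1 //.
by apply: (measurableT_comp (measurable_powR _)) => //; exact: mf.
Qed.

Lemma le_bigmaxe_EFin (S : finType) (F : S -> \bar R) (r : R) :
  (r%:E <= \big[maxe/-oo]_x F x)%E = [exists x, (r%:E <= F x)%E].
Proof.
apply/idP/existsP => [|[x hx]]; last by rewrite (bigD1 x) //= le_max hx.
elim/big_ind : _ => [//|a b IHa IHb|x _ hx]; last by exists x.
by rewrite le_max => /orP[/IHa|/IHb].
Qed.

(** The mixing time is at least [r] when some state is, for every [t < r], still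
    far from equilibrium at some later time: a countable combination of
    measurable events. *)
Lemma measurable_mixing_time_ge (S : finType) (P : T -> S -> S -> R)
    (pi : T -> S -> R) (eps r : R) :
  (forall x y, measurable_fun setT (fun o => P o x y)) ->
  (forall x, measurable_fun setT (fun o => pi o x)) ->
  measurable [set o | (r%:E <= mixing_time (P o) (pi o) eps)%E].
Proof.
move=> mP mpi.
have mpow t : forall x y, measurable_fun setT (fun o => kernel_pow (P o) t x y).
  elim: t => [|t IH] x y /=; first exact: measurable_cst.
  by apply: measurable_sum => z; apply: measurable_funM.
have mtv x t : measurable_fun setT (fun o => tv_dist (P o) (pi o) x t).
  apply: measurable_fun_bigmax => A; apply: measurableT_comp => //.
  by apply: measurable_funB; apply: measurable_fun_sumP.
have -> : [set o | (r%:E <= mixing_time (P o) (pi o) eps)%E] =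
    \bigcup_(x in [set: S]) \bigcap_(t in [set t : nat | t%:R < r])
      \bigcup_(t' in [set t' | (t <= t')%N])
        [set o | eps < tv_dist (P o) (pi o) x t'].
  apply/seteqP; split => o /=; rewrite /mixing_time.
    rewrite le_bigmaxe_EFin.
    move=> /existsP[x hx]; exists x => // t /= tr; apply: contrapT => no.
    move: hx; rewrite leNgt => /negP; apply.
    apply: (@le_lt_trans _ _ (t%:R)%:E); last by rewrite lte_fin.
    apply: ereal_inf_lbound; exists t => //= t' tt'; rewrite leNgt.
    by apply/negP => lt; apply: no; exists t'.
  move=> [x _ hx]; rewrite (bigD1 x) //= le_max; apply/orP; left.
  apply: le_ereal_inf_tmp => _ [t /= ht <-]; rewrite lee_fin leNgt.
  apply/negP => /hx [t' /= tt']; apply/negP; rewrite -leNgt; exact: ht.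
apply: fin_bigcup_measurable => // x _.
rewrite bigcap_mkcond; apply: bigcapT_measurable => t.
case: ifP => _; last exact: measurableT.
apply: bigcup_measurable => t' _.
rewrite -[X in measurable X]setTI.
exact: (measurable_fun_ltr (measurable_cst eps) (mtv x t') measurableT
  (Y := [set true])).
Qed.

Lemma measurable_P_MH p (pi : T -> {set 'I_p} -> R) :
  (forall o gamma, 0 <= pi o gamma) ->
  (forall gamma, measurable_fun setT (fun o => pi o gamma)) ->
  forall gamma gamma', measurable_fun setT (fun o => P_MH (pi o) gamma gamma').
Proof.
move=> pi0 mpi.
have mM gamma gamma' : measurable_fun setT (fun o => MH_move (pi o) gamma gamma').
  have macc : measurable_fun setT (fun o => Num.min 1 (pi o gamma' / pi o gamma)).
    apply: measurable_minr; first exact: measurable_cst.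
    by apply: measurable_funM => //; apply: measurable_fun_invr_ge0.
  rewrite /MH_move; case: (N1 gamma gamma'); [|case: (N2 gamma gamma')];
    last exact: measurable_cst.
  - by apply: measurable_funM => //; exact: measurable_cst.
  - by apply: measurable_funM => //; exact: measurable_cst.
move=> gamma gamma'; rewrite /P_MH; case: (gamma' == gamma) => //.
apply: measurable_funB; first exact: measurable_cst.
exact: measurable_fun_sumP.
Qed.

Lemma measurable_posterior n p (kappa g : R) (X : 'M[R]_(n, p))
    (Y : T -> 'cV[R]_n) :
  (forall i, measurable_fun setT (fun o => Y o i 0)) ->
  forall gamma, measurable_fun setT (fun o => posterior kappa g X (Y o) gamma).
Proof.
move=> mY.
have mR gamma : measurable_fun setT (fun o => Rsq X (Y o) gamma).
  apply: measurable_funM; last first.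
    apply: measurable_fun_invr_ge0 => [t|]; first by apply: sumr_ge0 => i _; exact: sqr_ge0.
    by apply: measurable_sum => i; apply: measurable_funX.
  under eq_fun do rewrite mxE.
  apply: measurable_sum => i; apply: measurable_funM => //.
  under eq_fun do rewrite mxE.
  apply: measurable_sum => j; apply: measurable_funM; last exact: measurable_cst.
  under eq_fun do rewrite mxE. exact: mY.
have mW gamma : measurable_fun setT (fun o => posterior_weight kappa g X (Y o) gamma).
  apply: measurable_funM; first exact: measurable_cst.
  apply: measurable_funM; first exact: measurable_cst.
  apply: measurable_fun_invr_ge0 => [t|]; first exact: powR_ge0.
  apply: (measurableT_comp (measurable_powR _)).
  apply: measurable_funD; first exact: measurable_cst.
  apply: measurable_funM; first exact: measurable_cst.
  by apply: measurable_funB => //; exact: measurable_cst.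
move=> gamma; apply: measurable_funM => //; apply: measurable_fun_invr_ge0.
  by move=> o; apply: sumr_ge0 => a _; rewrite !mulr_ge0 ?invr_ge0 ?powR_ge0.
by apply: measurable_sum.
Qed.

End Measurability.

(** * Standard Gaussian vectors *)

Section Gaussian1.
Context {R : realType}.

Lemma normal_peak1_le : normal_peak (1 : R) <= 2^-1.
Proof.
rewrite /normal_peak expr1n mul1r lef_pV2 ?posrE //; last first.
  by rewrite sqrtr_gt0 mulrn_wgt0 // pi_gt0.
have -> : (2 : R) = Num.sqrt (2 ^+ 2) by rewrite sqrtr_sqr ger0_norm.
rewrite ler_wsqrtr // expr2 -[X in _ <= X]mulr_natr ler_wpM2r //; exact: pi_ge2.
Qed.

Lemma normal_prob_itv_le (a b : R) : a <= b ->
  (normal_prob 0 1 `[a, b[ <= ((b - a) / 2)%:E)%E.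
Proof.
move=> ab; rewrite /normal_prob.
apply: (@le_trans _ _ (\int[lebesgue_measure]_(x in `[a, b[) (cst (2^-1)%:E x))%E).
  apply: ge0_le_integral => //=.
  - by move=> x _; rewrite lee_fin normal_pdf_ge0.
  - by apply/measurable_EFinP; apply: measurable_funTS; exact: measurable_normal_pdf.
  - move=> x _; rewrite lee_fin (le_trans (normal_pdf_ub _ _ _)) ?oner_neq0 //.
    exact: normal_peak1_le.
rewrite integral_cst //= lebesgue_measure_itv /= lte_fin.
case: ifP => [_|]; first by rewrite -EFinB -EFinM mulrC.
by rewrite mule0 lee_fin => _; rewrite divr_ge0 // subr_ge0.
Qed.

(** Tilting: where [m ^+ 2 <= m * x], the density of N(0,1) is at most
    exp(-m^2/2) times the density of N(m,1). *)
Lemma normal_prob_tail_le (m : R) (D : set R) : measurable D ->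
  (forall x, D x -> m ^+ 2 <= m * x) ->
  (normal_prob 0 1 D <= (expR (- m ^+ 2 / 2))%:E)%E.
Proof.
move=> mD hD.
apply: (@le_trans _ _ ((expR (- m ^+ 2 / 2))%:E * normal_prob m 1 D)%E); last first.
  rewrite -[leRHS]mule1 lee_wpmul2l ?lee_fin ?expR_ge0 //.
  exact: probability_le1.
rewrite /normal_prob -ge0_integralZl //=; last 2 first.
- by apply/measurable_EFinP; apply: measurable_funTS; exact: measurable_normal_pdf.
- by move=> x _; rewrite lee_fin normal_pdf_ge0.
apply: ge0_le_integral => //=.
- by move=> x _; rewrite lee_fin normal_pdf_ge0.
- by apply/measurable_EFinP; apply: measurable_funTS; exact: measurable_normal_pdf.
- apply/measurable_EFinP; apply: measurable_funM; first exact: measurable_cst.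
  by apply: measurable_funTS; exact: measurable_normal_pdf.
move=> x Dx; rewrite -EFinM lee_fin !normal_pdfE ?oner_neq0 //.
rewrite mulrCA ler_wpM2l ?normal_peak_ge0 // /normal_fun -expRD ler_expR.
by have := hD x Dx; rewrite subr0 expr1n; lra.
Qed.

Lemma normal_prob_norm_ge (L : R) : 0 <= L ->
  (normal_prob 0 1 [set x | (L <= `|x|)%R] <= (2 * expR (- L ^+ 2 / 2))%:E)%E.
Proof.
move=> L0.
have -> : [set x : R | L <= `|x|] = `[L, +oo[ `|` `]-oo, - L].
  apply/seteqP; split => x /=; rewrite !in_itv /= ?andbT.
    by rewrite lerNr; case: (ger0P x) => _; [left|right].
  move=> [h|h]; first by rewrite (le_trans h) // ler_norm.
  by rewrite (@le_trans _ _ (- x)) 1?lerNr // -normrN ler_norm.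
apply: (le_trans (measureU2 _ _ _)) => //.
rewrite mulr_natl mulr2n EFinD; apply: leeD.
  apply: normal_prob_tail_le => // x; rewrite /= in_itv /= andbT => h.
  by rewrite expr2 ler_wpM2l.
rewrite -(sqrrN L); apply: normal_prob_tail_le => // x; rewrite /= in_itv /= => h.
by rewrite expr2 ler_wnM2l // oppr_le0.
Qed.

End Gaussian1.

Section Cells.
Context {R : realType}.
Variables (L h : R) (N : nat).
Hypotheses (L0 : 0 <= L) (h0 : 0 < h) (hN : 2 * L < N.+1%:R * h).

(** The interval [-L, L[ is cut into cells of length [h]; points outside the
    grid fall into cell 0. *)
Definition cell (x : R) : 'I_N.+1 := inord (Num.truncn ((x + L) / h)).

Definition cell_left (a : 'I_N.+1) : R := a%:R * h - L.

Lemma cell_approx x : `|x| < L ->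
  x \in `[cell_left (cell x), cell_left (cell x) + h[%R.
Proof.
move=> xL; move: (xL); rewrite ltr_norml => /andP[Lx xL'].
have y0 : 0 <= (x + L) / h by rewrite divr_ge0 ?(ltW h0) //; lra.
have := truncn_itv y0; rewrite ler_pdivlMr // ltr_pdivrMr // => /andP[h1 h2].
rewrite in_itv /= /cell_left inordK; last first.
  by rewrite truncn_lt_nat // ltr_pdivrMr //; apply: lt_trans hN; lra.
by move: h2; rewrite -natr1 => h2; apply/andP; split; lra.
Qed.

Lemma cell_preimage (a : 'I_N.+1) : a != ord0 ->
  cell @^-1` [set a] = `[cell_left a, cell_left a + h[.
Proof.
move=> a0; have aN0 : (0 < a)%N by rewrite lt0n.
have trE x : (Num.truncn ((x + L) / h) == a) = (x \in `[cell_left a, cell_left a + h[%R).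
  rewrite in_itv /= /cell_left.
  have [y0|y0] := leP 0 ((x + L) / h).
    rewrite truncn_eq // ler_pdivlMr // ltr_pdivrMr // -natr1.
    by congr (_ && _); apply/idP/idP; lra.
  have -> : Num.truncn ((x + L) / h) = 0%N.
    by apply/truncn0Pn; rewrite -ltNge (lt_trans y0).
  rewrite eq_sym -[LHS]negbK -lt0n aN0 /=; symmetry; apply/negbTE.
  have : x + L < 0 by move: y0; rewrite ltr_pdivrMr // mul0r.
  have : 0 < a%:R * h by rewrite mulr_gt0 // ltr0n.
  by move=> h1 h2; apply/negP => /andP[]; lra.
apply/seteqP; split => x /=; rewrite -trE /cell.
  move=> e; have [lt|ge] := ltnP (Num.truncn ((x + L) / h)) N.+1.
    by rewrite -e inordK.
  move: a0; rewrite -e /inord /insubd insubN ?eqxx //.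
  by rewrite -leqNgt.
by move=> /eqP e; apply: val_inj; rewrite /= e inordK.
Qed.

Lemma measurable_cell (a : 'I_N.+1) : measurable (cell @^-1` [set a]).
Proof.
have m b : b != ord0 -> measurable (cell @^-1` [set b]).
  by move=> b0; rewrite cell_preimage.
case: (eqVneq a ord0) => [->|]; last exact: m.
have -> : cell @^-1` [set ord0] =
    ~` \bigcup_(b in [set b | b != ord0]) cell @^-1` [set b].
  apply/seteqP; split => x /=.
    by move=> e [b /= b0]; rewrite e => eb; rewrite -eb eqxx in b0.
  by move=> no; apply: contrapT => /eqP ne; apply: no; exists (cell x).
by apply: measurableC; apply: fin_bigcup_measurable => [|b];
  [exact: finite_finset|exact: m].
Qed.

Definition cell_prob (a : 'I_N.+1) : R :=
  fine (normal_prob 0 1 (cell @^-1` [set a])).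

Lemma cell_probE a : normal_prob 0 1 (cell @^-1` [set a]) = (cell_prob a)%:E.
Proof. by rewrite fineK // fin_num_measure //; exact: measurable_cell. Qed.

Lemma cell_prob_ge0 a : 0 <= cell_prob a.
Proof. by rewrite fine_ge0. Qed.

Lemma cell_prob_sum1 : \sum_a cell_prob a = 1.
Proof.
apply: EFin_inj; rewrite -sumEFin.
under eq_bigr do rewrite -cell_probE.
rewrite -measure_bigsetU_ord; last 2 first.
- exact: measurable_cell.
- by move=> a b _ _ [x [/= <- <-]].
rewrite -(probability_setT (normal_prob 0 1)); congr (normal_prob 0 1 _).
by apply/seteqP; split => // x _; rewrite (bigD1 (cell x)) //=; left.
Qed.

Lemma cell_prob_le a : 4 * expR (- L ^+ 2 / 2) <= h -> cell_prob a <= h.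
Proof.
have hh : h / 2 <= h by have := h0; lra.
move=> hL; rewrite -lee_fin -cell_probE.
have itv_le b : (normal_prob 0 1 `[cell_left b, (cell_left b + h)%R[ <= (h / 2)%:E)%E.
  have hb : cell_left b <= cell_left b + h by rewrite lerDl ltW.
  by apply: le_trans (normal_prob_itv_le hb) _; rewrite addrAC subrr add0r.
case: (eqVneq a ord0) => [->|a0]; last first.
  by rewrite cell_preimage // (le_trans (itv_le a)) // lee_fin.
have mL : measurable [set x : R | L <= `|x|].
  rewrite -[X in measurable X]setTI.
  exact: (measurable_fun_ler (measurable_cst L) (@normr_measurable R setT)
    measurableT (Y := [set true])).
apply: (@le_trans _ _ (normal_prob 0 1
    (`[cell_left ord0, (cell_left ord0 + h)%R[ `|` [set x : R | (L <= `|x|)%R]))).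
  apply: le_measure; rewrite ?inE //; [exact: measurable_cell|exact: measurableU|].
  by move=> x /= cx; have [/cell_approx|ge] := ltP `|x| L; [rewrite cx; left|right].
apply: (@le_trans _ _ (normal_prob 0 1 `[cell_left ord0, (cell_left ord0 + h)%R[ +
    normal_prob 0 1 [set x : R | (L <= `|x|)%R])%E); first exact: measureU2.
apply: (@le_trans _ _ ((h / 2)%:E + (2 * expR (- L ^+ 2 / 2))%:E)%E).
  by apply: leeD; [exact: itv_le|exact: normal_prob_norm_ge].
by rewrite -EFinD lee_fin; lra.
Qed.

(** Cells whose left ends lie in an interval of length [2 * s] are at most
    [2 * s / h + 1] in number. *)
Lemma cell_prob_interval_le s z : 0 <= s -> (forall a, cell_prob a <= h) ->
  \sum_(a | `|cell_left a + z| <= s) cell_prob a <= 2 * s + h.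
Proof.
move=> s0 ch.
pose A := [pred a : 'I_N.+1 | `|cell_left a + z| <= s].
pose K := Num.truncn (2 * s / h).
have K_le : K%:R * h <= 2 * s.
  by rewrite -ler_pdivlMr // truncn_le divr_ge0 ?mulr_ge0 // ltW.
suff cA : (#|A| <= K.+1)%N.
  apply: (@le_trans _ _ (\sum_(a in A) h)); first exact: ler_sum.
  rewrite sumr_const -[_ *+ #|_|]mulr_natl.
  apply: (@le_trans _ _ (K.+1%:R * h)); first by rewrite ler_pM2r // ler_nat.
  by rewrite -natr1 mulrDl mul1r lerD2r.
case: (pickP A) => [a1 Aa1|A0]; last by rewrite eq_card0.
pose a0 := [arg min_(a < a1 | A a) (a : nat)].
have [a0A a0min] : A a0 /\ forall a, A a -> (a0 <= a)%N.
  by rewrite /a0; case: arg_minnP.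
have near a : A a -> (a < a0 + K.+1)%N.
  move=> Aa; rewrite -ltn_subLR ?a0min // ltnS truncn_ge_nat; last first.
    by rewrite divr_ge0 ?mulr_ge0 // ltW.
  rewrite ler_pdivlMr // natrB ?a0min //.
  move: Aa a0A; rewrite /A /= /cell_left !ler_norml => /andP[h1 h2] /andP[h3 h4].
  by rewrite mulrBl; lra.
rewrite cardE -(size_map val) -(size_iota a0 K.+1); apply: uniq_leq_size.
  by rewrite map_inj_uniq ?enum_uniq //; exact: val_inj.
move=> x /mapP[a + ->]; rewrite mem_enum => Aa.
by rewrite mem_iota a0min // near.
Qed.

End Cells.

Section GoodEvent.
Context {R : realType} {d : measure_display} {T : measurableType d}.
Variable P : probability T R.

Lemma probability_bigsetU_le (I : Type) (r : seq I) (Q : pred I) (F : I -> set T) :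
  (forall i, measurable (F i)) ->
  (P (\big[setU/set0]_(i <- r | Q i) F i) <= \sum_(i <- r | Q i) P (F i))%E.
Proof.
move=> mF; elim: r => [|i r IH]; first by rewrite !big_nil measure0.
rewrite !big_cons; case: ifP => // _.
have mU : measurable (\big[setU/set0]_(j <- r | Q j) F j) by apply: bigsetU_measurable.
by apply: le_trans (measureU2 _ (mF i) mU) _; apply: leeD.
Qed.

Context {n : nat}.
Variable w : 'I_n -> {RV P >-> R}.
Hypothesis w_gauss : standard_gaussian w.

Lemma gaussian_preimage i (B : set R) : measurable B ->
  P (w i @^-1` B) = normal_prob 0 1 B.
Proof. by move=> mB; rewrite -(w_gauss.1 i B mB). Qed.

Lemma gaussian_cells (L h : R) N (k : {ffun 'I_n -> 'I_N.+1}) : 0 < h ->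
  P (\bigcap_(i in [set` [set: 'I_n]%SET]) (w i @^-1` (cell L h N @^-1` [set k i]))) =
  (prod_law (cell_prob L h (N:=N)) k)%:E.
Proof.
move=> h0; have mc a : measurable (cell L h N @^-1` [set a] : set R).
  exact: measurable_cell.
rewrite (w_gauss.2 _ (fun i => cell L h N @^-1` [set k i])) //.
rewrite /prod_law -prodEFin; apply: eq_big => [i|i _]; first by rewrite inE.
by rewrite gaussian_preimage // cell_probE.
Qed.

(** Rounding to the grid moves any [v . w] with [|v|_oo <= 1] by at most
    [n * h = s], so the discrete estimate at level [2 * s] controls the
    Gaussian vector at level [s]. *)
Lemma gaussian_not_almost_ortho (J : finType) (Gamma : {set J})
    (V : J -> 'M[R]_n) (m : nat) (s L : R) :
  (0 < n)%N -> 0 < s -> 0 <= L -> 4 * expR (- L ^+ 2 / 2) <= s / n%:R ->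
  (forall gamma, gamma \in Gamma -> (m <= \rank (V gamma))%N) ->
  exists G : set T, [/\ measurable G,
    ((1 - (2 * n%:R * expR (- L ^+ 2 / 2) + #|Gamma|%:R * (5 * s) ^+ m))%:E <= P G)%E &
    forall omega, G omega -> (forall i, `|w i omega| < L) /\
      forall gamma, gamma \in Gamma -> exists v : 'rV[R]_n,
        [/\ (v <= V gamma)%MS, forall i, `|v 0 i| <= 1 &
            s < `|\sum_i v 0 i * w i omega|]].
Proof.
move=> n0 s0 L0 hL rV; pose h := s / n%:R.
have nR0 : 0 < n%:R :> R by rewrite ltr0n.
have h0 : 0 < h by rewrite divr_gt0.
have nh : n%:R * h = s by rewrite /h mulrC divfK // gt_eqF.
have hs : h <= s by rewrite -nh ler_peMl ?(ltW h0) // ler1n.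
pose N := Num.truncn (2 * L / h).
have hN : 2 * L < N.+1%:R * h by rewrite -ltr_pdivrMr // truncnS_gt.
pose rep := @cell_left R L h N.
pose bad k := [exists gamma in Gamma, almost_ortho rep (2 * s) (V gamma) k].
pose C (k : {ffun 'I_n -> 'I_N.+1}) :=
  \bigcap_(i in [set` [set: 'I_n]%SET]) (w i @^-1` (cell L h N @^-1` [set k i])).
pose B1 := \big[setU/set0]_(i < n) (w i @^-1` [set x : R | L <= `|x|]).
pose B2 := \big[setU/set0]_(k | bad k) C k.
have mL : measurable [set x : R | L <= `|x|].
  rewrite -[X in measurable X]setTI.
  exact: (measurable_fun_ler (measurable_cst L) (@normr_measurable R setT)
    measurableT (Y := [set true])).
have mw i (B : set R) : measurable B -> measurable (w i @^-1` B).
  by move=> mB; rewrite -[X in measurable X]setTI; apply: measurable_funP.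
have mC k : measurable (C k).
  apply: fin_bigcap_measurable => [|i _]; first exact: finite_finset.
  by apply: mw; exact: measurable_cell.
have mB1 : measurable B1 by apply: bigsetU_measurable => i _; exact: mw.
have mB2 : measurable B2 by apply: bigsetU_measurable => k _; exact: mC.
exists (~` (B1 `|` B2)); split; first by apply/measurableC/measurableU.
  rewrite probability_setC; last exact: measurableU.
  rewrite EFinB; apply: leeB => //.
  apply: le_trans (measureU2 _ mB1 mB2) _; rewrite EFinD; apply: leeD.
    apply: le_trans (probability_bigsetU_le _ _ _) _ => [i|]; first exact: mw.
    apply: (@le_trans _ _ (\sum_(i < n) (2 * expR (- L ^+ 2 / 2))%:E)%E).
      apply: lee_sum => i _; rewrite gaussian_preimage //.
      exact: normal_prob_norm_ge.
    by rewrite sumEFin sumr_const card_ord lee_fin -[_ *+ n]mulr_natl mulrCA mulrA.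
  apply: le_trans (probability_bigsetU_le _ _ _) _ => //.
  under eq_bigr do rewrite gaussian_cells //.
  rewrite sumEFin lee_fin.
  apply: (@le_trans _ _ (\sum_(gamma in Gamma)
      \sum_(k | almost_ortho rep (2 * s) (V gamma) k) prod_law (cell_prob L h (N:=N)) k)).
    under [leRHS]eq_bigr => gamma _ do rewrite big_mkcond /=.
    rewrite exchange_big /= big_mkcond; apply: ler_sum => k _.
    have W0 : 0 <= prod_law (cell_prob L h (N:=N)) k.
      by apply: prod_law_ge0 => a; exact: cell_prob_ge0.
    case: ifP => [/existsP[gamma /andP[gG ao]]|_].
      rewrite (bigD1 gamma) //= ao lerDl; apply: sumr_ge0 => g _.
      by case: ifP.
    by apply: sumr_ge0 => g _; case: ifP.
  rewrite [leRHS]mulr_natl -sumr_const.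
  apply: ler_sum => gamma gG.
  apply: small_ball; [exact: cell_prob_ge0|exact: cell_prob_sum1| |exact: rV].
  move=> z; apply: (@le_trans _ _ (2 * (2 * s) + h)); last by lra.
  apply: cell_prob_interval_le => //; first by rewrite mulr_ge0 // ltW.
  by move=> a; exact: cell_prob_le.
move=> omega; rewrite setCU => -[nB1 nB2].
have wL i : `|w i omega| < L.
  rewrite ltNge; apply/negP => ge; apply: nB1.
  by rewrite /B1 (bigD1 i) //=; left.
split=> // gamma gG; apply: contrapT => no; apply: nB2.
pose k : {ffun 'I_n -> 'I_N.+1} := [ffun i => cell L h N (w i omega)].
have badk : bad k.
  apply/existsP; exists gamma; rewrite gG /=; apply/asboolP => v vV v1.
  have vw : `|\sum_i v 0 i * w i omega| <= s.
    by rewrite leNgt; apply/negP => lt; apply: no; exists v.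
  have -> : \sum_i v 0 i * rep (k i) = \sum_i v 0 i * w i omega -
      \sum_i v 0 i * (w i omega - rep (k i)).
    by rewrite -sumrB; apply: eq_bigr => i _; ring.
  rewrite (le_trans (ler_normB _ _)) // mulr_natl mulr2n lerD //.
  rewrite (le_trans (ler_norm_sum _ _ _)) // -[leRHS]nh.
  have -> : n%:R * h = \sum_(i < n) h by rewrite sumr_const card_ord mulr_natl.
  apply: ler_sum => i _; rewrite normrM -[leRHS]mul1r ler_pM //.
  have := cell_approx h0 hN (wL i); rewrite in_itv /= /k ffunE -/rep => /andP[h1 h2].
  by rewrite ger0_norm ?subr_ge0 // lerBlDl ltW.
by rewrite /B2 (bigD1 k) //=; left => i _ /=; rewrite ffunE.
Qed.

End GoodEvent.

(** * Choice of the scales *)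

Section Scales.
Context {R : realType}.
Variables (alpha kappa : R) (n : nat).

(* The posterior compares exponentials in [n], so all the scales are expressed
   through the logarithm of [n]. *)
Let l : R := ln n%:R.
Let c : R := kappa + alpha + 1 / 2.

(** The number of missing variables at the boundary of the bottleneck: the
    largest one for which the prior terms [m * ln n] stay of order [n]. *)
Definition boundary_depth : nat := Num.truncn (n%:R / l).

(** The factor 60 makes [5 * slab_width] equal to m / (12 n), small enough for
    [level_union_bound]. *)
Definition slab_width : R := boundary_depth%:R / (60 * n%:R).

(** A coordinate exceeds this bound with probability at most 2 / n^2. *)
Definition noise_bound : R := Num.sqrt (4 * l).

Hypothesis n_gt0 : (0 < n)%N.
Hypothesis alpha1 : 1 < alpha.
Hypothesis kappa0 : 0 < kappa.
(* As [n / l >= l / 2], this makes [m >= 240], which absorbs the constants 4 and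
   60 in [noise_tail_le]. *)
Hypothesis l_large : 480 <= l.
(* By [expR x >= x ^+ 4 / 24] at [x = (2 * alpha - 2) * l], this makes
   n^(2 alpha - 2) beat the factor [l ^+ 3] lost to [s ^+ 2] and [L ^+ 2]. *)
Hypothesis l_large_alpha :
  expR (2 * (c + 2)) * (240 ^+ 2 * 24) <= (2 * alpha - 2) ^+ 4 * l.

Let m : nat := boundary_depth.
Let s : R := slab_width.
Let L : R := noise_bound.

Lemma expR_ln_n : expR l = n%:R.
Proof. by rewrite lnK // posrE ltr0n. Qed.

Lemma boundary_depth_bounds :
  [/\ 240 <= m%:R :> R, m%:R * l <= n%:R, n%:R <= 2 * l * m%:R & (m <= n)%N].
Proof.
have l480 := l_large; have l0 : 0 < l by lra.
have y0 : 0 <= n%:R / l by rewrite divr_ge0 // ltW.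
have := truncn_itv y0; rewrite -/boundary_depth -/m => /andP[h1 h2].
have ml : m%:R * l <= n%:R by rewrite -ler_pdivlMr.
have h3 : n%:R < (m%:R + 1) * l by rewrite natr1 -ltr_pdivrMr.
have n_l2 : l ^+ 2 / 2 <= n%:R.
  rewrite -expR_ln_n; apply: le_trans (expR_ge1Dxn 1 (ltW l0)).
  have -> : 2`! = 2 by [].
  by rewrite lerDr.
have m240 : (240 <= m)%N.
  rewrite -ltnS -(ltr_nat R) -[m.+1%:R]natr1 -(ltr_pM2r l0); apply: le_lt_trans h3.
  apply: le_trans n_l2.
  have : 0 <= (l - 480) * l.
    by apply: mulr_ge0; [rewrite subr_ge0; exact: l480|exact: ltW].
  by rewrite expr2; lra.
have m1 : 1 <= m%:R :> R by rewrite ler1n (leq_trans _ m240).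
split=> //; first by rewrite ler_nat.
  apply: le_trans (ltW h3) _.
  have : 0 <= (m%:R - 1) * l by rewrite mulr_ge0 ?subr_ge0 // ltW.
  by lra.
rewrite -(ler_nat R); apply: le_trans ml.
have : 0 <= m%:R * (l - 1) by rewrite mulr_ge0 // subr_ge0; lra.
by lra.
Qed.

Let g : R := n%:R `^ (2 * alpha).

Lemma prior_scale : g = expR (2 * alpha * l).
Proof. by rewrite /g /powR gt_eqF // ltr0n. Qed.

Lemma prior_scale_ge0 : 0 <= g.
Proof. by rewrite prior_scale expR_ge0. Qed.

Lemma log_cost_depth_le : m%:R * @log_cost R n kappa g <= c * n%:R.
Proof.
have [_ ml _ _] := boundary_depth_bounds.
have l480 := l_large; have a1 := alpha1; have k0 := kappa0.
have hln : ln (1 + g) <= (2 * alpha + 1) * l.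
  rewrite -[leRHS]expRK ler_ln ?posrE ?expR_gt0 //; last first.
    by have := prior_scale_ge0; lra.
  rewrite mulrDl mul1r expRD -prior_scale.
  have g1 : 1 <= g.
    rewrite prior_scale; apply: le_trans (expR_ge1Dx _); rewrite lerDl.
    by rewrite !mulr_ge0; lra.
  have e2 : 2 <= expR l by apply: le_trans (expR_ge1Dx _); lra.
  have : 0 <= g * (expR l - 2) by rewrite mulr_ge0 ?subr_ge0; lra.
  by lra.
apply: (@le_trans _ _ (c * (m%:R * l))); last first.
  by rewrite ler_wpM2l // /c; lra.
rewrite mulrCA ler_wpM2l // /log_cost /c -/l.
by move: hln; lra.
Qed.

Lemma noise_boundE : noise_bound ^+ 2 = 4 * l.
Proof. by rewrite sqr_sqrtr // mulr_ge0 //; have := l_large; lra. Qed.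

Lemma noise_tail : expR (- L ^+ 2 / 2) = n%:R^-1 ^+ 2.
Proof.
rewrite /L noise_boundE -expR_ln_n -expRN -expRM_natl; congr expR.
by field.
Qed.

Lemma noise_tail_le : 4 * expR (- L ^+ 2 / 2) <= s / n%:R.
Proof.
have [m240 _ _ _] := boundary_depth_bounds.
have n0 : 0 < n%:R :> R by rewrite ltr0n.
have -> : s / n%:R = m%:R / 60 * n%:R^-1 ^+ 2.
  by rewrite /s /slab_width -/m; field; rewrite gt_eqF.
rewrite noise_tail ler_wpM2r // ?exprn_ge0 ?invr_ge0 //.
by rewrite ler_pdivlMr //; apply: le_trans m240; lra.
Qed.

Lemma noise_union_le : 2 * n%:R * expR (- L ^+ 2 / 2) <= 1 / 4.
Proof.
have [m240 _ _ mn] := boundary_depth_bounds.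
have n240 : 8 <= n%:R :> R.
  apply: (@le_trans _ _ m%:R); last by rewrite ler_nat.
  by apply: le_trans m240; lra.
have n0 : 0 < n%:R :> R by rewrite ltr0n.
rewrite noise_tail.
have -> : 2 * n%:R * n%:R^-1 ^+ 2 = 2 / n%:R :> R by field; rewrite gt_eqF.
by rewrite ler_pdivrMr //; lra.
Qed.

(** After the slab estimate the unexplained fraction is at least
    s^2 / (n L)^2, of order n^-2 up to logarithms; this is where
    [alpha > 1] makes [g] large enough. *)
Lemma fit_scale_ge :
  expR (2 * (c + 2)) <= g * (s ^+ 2 / (n%:R ^+ 2 * L ^+ 2)).
Proof.
have [m240 _ nlm _] := boundary_depth_bounds.
have l480 := l_large; have a1 := alpha1.
have n0 : 0 < n%:R :> R by rewrite ltr0n.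
have l0 : 0 < l by lra.
set M := expR _; pose E := expR ((2 * alpha - 2) * l).
have M0 : 0 <= M by exact: expR_ge0.
have gE : g = E * n%:R ^+ 2.
  rewrite prior_scale -expR_ln_n -expRM_natl /E -expRD; congr expR.
  by ring.
have E_ge : M * 240 ^+ 2 * l ^+ 3 <= E.
  have b0 : 0 <= (2 * alpha - 2) * l by rewrite mulr_ge0; lra.
  apply: le_trans (expR_ge1Dxn 3 b0); apply: ler_wpDl => //.
  have -> : 4`! = 24 by [].
  rewrite ler_pdivlMr // exprMn.
  have := ler_wpM2r (exprn_ge0 3 (ltW l0)) l_large_alpha; rewrite -/M.
  by rewrite !exprS expr0; lra.
have -> : g * (s ^+ 2 / (n%:R ^+ 2 * L ^+ 2)) =
    E * (m%:R / n%:R) ^+ 2 / (120 ^+ 2 * l).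
  rewrite gE /L noise_boundE /s /slab_width -/m.
  by field; rewrite !gt_eqF.
have mn2 : (2 * l)^-1 <= m%:R / n%:R.
  by rewrite ler_pdivlMr // mulrC ler_pdivrMr ?mulr_gt0 // mulrC.
rewrite ler_pdivlMr ?mulr_gt0 ?exprn_gt0 //.
apply: (@le_trans _ _ (E * (2 * l)^-1 ^+ 2)); last first.
  rewrite ler_wpM2l ?expR_ge0 //.
  by rewrite lerXn2r ?nnegrE ?divr_ge0 ?invr_ge0 ?mulr_ge0 // ltW.
rewrite exprVn ler_pdivlMr ?exprn_gt0 ?mulr_gt0 //.
apply: le_trans E_ge; rewrite le_eqVlt; apply/orP; left; apply/eqP.
by field.
Qed.

End Scales.

(** * Exponential mixing time *)

(** For a single sample size: a Gaussian vector avoids all the slabs of the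
    boundary level with probability one half, and then every boundary model
    leaves a large residual. *)
Lemma mixing_time_probability_ge (R : realType) (alpha kappa eps : R) (n : nat)
    (X : 'M[R]_n) (d : measure_display) (T : measurableType d)
    (P : probability T R) (w : 'I_n -> {RV P >-> R}) :
  let pi omega := posterior kappa (n%:R `^ (2 * alpha)) X (\col_i w i omega) in
  let c := kappa + alpha + 1 / 2 in
  (0 < n)%N -> 1 < alpha -> 0 < kappa -> eps < 1 / 2 -> X \in unitmx ->
  standard_gaussian w ->
  480 <= ln n%:R :> R -> c + 2 <= kappa * ln n%:R ->
  expR (2 * (c + 2)) * (240 ^+ 2 * 24) <= (2 * alpha - 2) ^+ 4 * ln n%:R ->
  (P [set omega | ((expR (1 / 2 * n%:R))%:E <=
       mixing_time (P_MH (pi omega)) (pi omega) eps)%E] >= (1 / 2)%:E)%E.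
Proof.
move=> pi c n0 a1 k0 eps2 Xu wG h480 hk ha.
pose g : R := n%:R `^ (2 * alpha).
pose m := boundary_depth n (R := R).
pose s : R := slab_width n; pose L : R := noise_bound n.
have [m240 _ _ mn] : [/\ 240 <= m%:R :> R, m%:R * ln n%:R <= n%:R :> R,
    n%:R <= 2 * ln n%:R * m%:R :> R & (m <= n)%N] by exact: boundary_depth_bounds.
have m240n : (240 <= m)%N by rewrite -(ler_nat R).
have m2 : (1 < m)%N by apply: leq_trans m240n.
have nR0 : 0 < n%:R :> R by rewrite ltr0n.
have mR0 : 0 < m%:R :> R by rewrite ltr0n (leq_trans _ m2).
have s0 : 0 < s by rewrite divr_gt0 ?mulr_gt0.
have L0 : 0 <= L by exact: sqrtr_ge0.
have g0 : 0 <= g by exact: prior_scale_ge0.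
pose level := [set gamma : {set 'I_n} | #|gamma| == (n - m)%N]%SET.
pose V gamma := kermx (col_span X gamma)^T.
have rV gamma : gamma \in level -> (m <= \rank (V gamma))%N.
  rewrite inE => /eqP e; apply: leq_trans (rank_kermx_col_span X gamma).
  by rewrite e subKn.
have [G [mG PG hG]] :=
  gaussian_not_almost_ortho wG n0 s0 L0 (noise_tail_le n0 h480) rV.
have mpi gamma : measurable_fun setT (fun o => pi o gamma).
  apply: measurable_posterior => i.
  by under eq_fun do rewrite mxE; exact: measurable_funP.
have pi_gt0 o gamma : 0 < pi o gamma by exact: posterior_gt0.
have mE : measurable [set omega | ((expR (1 / 2 * n%:R))%:E <=
    mixing_time (P_MH (pi omega)) (pi omega) eps)%E].
  apply: measurable_mixing_time_ge => //; apply: measurable_P_MH => // o gamma.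
  exact/ltW.
apply: (@le_trans _ _ (P G)).
  apply: le_trans PG; rewrite lee_fin.
  have hu := noise_union_le n0 h480.
  have -> : 5 * s = m%:R / (12 * n%:R).
    by rewrite /s /slab_width -/m; field; rewrite gt_eqF.
  have hl := level_union_bound R m2 mn.
  have -> : 1 / 2 = 1 - (1 / 4 + 1 / 4) :> R by field.
  by apply: lerB => //; apply: lerD.
apply: le_measure; rewrite ?inE // => omega /hG[wL hV] /=.
set Y : 'cV[R]_n := \col_i w i omega.
have Ysum : \sum_i Y i 0 ^+ 2 = \sum_i w i omega ^+ 2.
  by apply: eq_bigr => i _; rewrite mxE.
have Y_le : \sum_i Y i 0 ^+ 2 <= n%:R * L ^+ 2.
  rewrite Ysum mulr_natl -[X in _ <= _ *+ X]card_ord -sumr_const.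
  apply: ler_sum => i _; rewrite -real_normK ?num_real //.
  by rewrite lerXn2r ?nnegrE // ltW.
have slab gamma : gamma \in level -> exists v : 'rV[R]_n,
    [/\ (v <= V gamma)%MS, \sum_i v 0 i ^+ 2 <= n%:R & s ^+ 2 < (v *m Y) 0 0 ^+ 2].
  move=> /hV[v [vV v1 vs]]; exists v; split=> //.
    rewrite -[X in _ <= X%:R]card_ord -sumr_const; apply: ler_sum => i _.
    by rewrite -real_normK ?num_real // exprn_ile1.
  have -> : (v *m Y) 0 0 = \sum_i v 0 i * w i omega.
    by rewrite mxE; apply: eq_bigr => i _; rewrite mxE.
  rewrite -[ltRHS]real_normK ?num_real // ltrXn2r ?nnegrE //; exact: ltW.
have Y0 : 0 < \sum_i Y i 0 ^+ 2.
  rewrite lt_neqAle eq_sym andbC sumr_ge0 => [|i _]; last exact: sqr_ge0.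
  apply/eqP => Yz.
  have Y00 : Y = 0.
    apply/matrixP => i j; rewrite ord1 [in RHS]mxE; apply/eqP.
    rewrite -sqrf_eq0; move/eqP: Yz.
    rewrite psumr_eq0 => [/allP/(_ i (mem_index_enum i))//|k _]; exact: sqr_ge0.
  have [gamma gl] : exists gamma, gamma \in level.
    apply/set0Pn; rewrite -card_gt0 /level card_draws card_ord bin_gt0.
    exact: leq_subr.
  have [v [_ _]] := slab gamma gl.
  rewrite Y00 mulmx0 mxE expr0n /= ltNge => /negP; apply.
  by rewrite exprn_ge0 // ltW.
apply: (posterior_mixing_time_ge n0 g0 Xu Y0 (ltW k0) eps2 _ (ltnW m2) mn
  (log_cost_depth_le n0 a1 k0 h480) hk).
  by apply: leq_trans mn; apply: leq_trans m240n.
move=> gamma e; have gl : gamma \in level by rewrite inE e.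
have [v [vV vn vs]] := slab gamma gl.
apply: le_trans (fit_scale_ge n0 a1 h480 ha) _.
rewrite -/g -/s -/L; apply: ler_wpDl => //; apply: ler_wpM2l => //.
have LR0 : 0 < L ^+ 2.
  by rewrite /L noise_boundE // mulr_gt0 //; lra.
rewrite ler_pdivrMr; last exact: mulr_gt0 (exprn_gt0 2 nR0) LR0.
apply: (le_trans (ltW vs)); apply: le_trans (Rsq_residual_ge Y0 vV) _.
have R1 : 0 <= 1 - Rsq X Y gamma by rewrite subr_ge0 Rsq_le1.
have -> : (1 - Rsq X Y gamma) * (n%:R ^+ 2 * L ^+ 2) =
    n%:R * ((1 - Rsq X Y gamma) * (n%:R * L ^+ 2)) by ring.
apply: ler_pM => //; first by apply: sumr_ge0 => i _; exact: sqr_ge0.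
  by rewrite mulr_ge0 // ltW.
by rewrite ler_wpM2l.
Qed.

Theorem mainTheorem3 (R : realType) (alpha kappa : R)
    (X : forall n : nat, 'M[R]_n)
    (d : nat -> measure_display) (T : forall n : nat, measurableType (d n))
    (P : forall n : nat, probability (T n) R)
    (w : forall n : nat, 'I_n -> {RV (P n) >-> R}) :
  1 < alpha -> 0 < kappa ->
  (forall n, X n \in unitmx) ->
  (forall n, standard_gaussian (w n)) ->
  forall eps : R, 0 < eps -> eps < 1 / 2 ->
  exists c : R, 0 < c /\
    \forall n \near \oo,
      let mixing (omega : T n) : \bar R :=
        let Y : 'cV[R]_n := \col_i w n i omega in
        let g : R := n%:R `^ (2 * alpha) in
        let pi : {set 'I_n} -> R := posterior kappa g (X n) Y in
        mixing_time (P_MH pi) pi eps in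
      (P n [set omega | (expR (c * n%:R))%:E <= mixing omega] >= (1 / 2)%:E)%E.
Proof.
move=> a1 k0 Xu wG eps eps0 eps2.
(* Escape probabilities are at most exp(- n), so any rate below 1 would do. *)
exists (1 / 2); split; first by rewrite divr_gt0.
pose c := kappa + alpha + 1 / 2.
pose b4 := (2 * alpha - 2) ^+ 4.
have b4_gt0 : 0 < b4 by rewrite exprn_gt0 //; lra.
pose l0 := Num.max 480 (Num.max ((c + 2) / kappa)
  (expR (2 * (c + 2)) * (240 ^+ 2 * 24) / b4)).
exists (Num.truncn (expR l0)).+1 => // n /= hn.
have ln_n : expR l0 < n%:R.
  by apply: lt_le_trans (truncnS_gt _) _; rewrite ler_nat.
have n0 : (0 < n)%N by apply: leq_trans hn.
have : l0 <= ln n%:R.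
  by rewrite -[l0]expRK ler_ln ?posrE ?expR_gt0 ?ltr0n // ltW.
rewrite /l0 !ge_max => /and3P[h1 h2 h3].
apply: mixing_time_probability_ge => //.
- by rewrite [leRHS]mulrC -ler_pdivrMr.
- by rewrite [leRHS]mulrC -ler_pdivrMr.
Qed.
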